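(* Let $\mathcal{S}$ be a stratified institution with a decomposition $$\mathcal{S}^0 \xleftarrow{\;(\Phi^0,\alpha^0,\beta^0)\;} \mathcal{S} \xrightarrow{\;(\Phi,\alpha,\widetilde\beta)\;} \widetilde{\mathcal{B}}^C$$ that admits diagrams, and suppose that these diagrams denote the stratification (with respect to a nominals extraction $(N,\mathrm{Nm})$ of $\mathcal S$). Then: (i) $\mathcal{S}^*$ has diagrams when $\mathcal{S}$ has explicit local satisfaction; and (ii) $\mathcal{S}^\sharp$ has diagrams when $\mathcal{S}$ has explicit local satisfaction and has $i$-sentences too.
   Context: **Institutions.** An institution $\mathcal{I}=(\mathrm{Sign},\mathrm{Sen},\mathrm{Mod},\models)$ consists of a category $\mathrm{Sign}$ of signatures, a functor $\mathrm{Sen}:\mathrm{Sign}\to\mathbf{Set}$, a functor $\mathrm{Mod}:\mathrm{Sign}^{\mathrm{op}}\to\mathbf{CAT}$ (reducts), and relations $\models_\Sigma\subseteq|\mathrm{Mod}(\Sigma)|\times\mathrm{Sen}(\Sigma)$ such that $M'\models\mathrm{Sen}(\varphi)\rho$ iff $\mathrm{Mod}(\varphi)M'\models\rho$. An institution morphism $(\Phi,\alpha,\beta):\mathcal{I}_2\to\mathcal{I}_1$ consists of a functor $\Phi:\mathrm{Sign}_2\to\mathrm{Sign}_1$ and natural transformations $\alpha:\Phi;\mathrm{Sen}_1\Rightarrow\mathrm{Sen}_2$, $\beta:\mathrm{Mod}_2\Rightarrow\Phi^{\mathrm{op}};\mathrm{Mod}_1$ with $M_2\models_2\alpha_\Sigma\rho$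 iff $\beta_\Sigma M_2\models_1\rho$. (Composition $;$ is diagrammatic.) **Stratified institutions.** A stratified institution $\mathcal{S}=(\mathrm{Sign},\mathrm{Sen},\mathrm{Mod},[\![\_]\!],\models)$ has a category $\mathrm{Sign}$ of signatures, a functor $\mathrm{Sen}:\mathrm{Sign}\to\mathbf{Set}$ and a functor $\mathrm{Mod}:\mathrm{Sign}^{\mathrm{op}}\to\mathbf{CAT}$; a stratification, i.e. a lax natural transformation given by functors $[\![\_]\!]_\Sigma:\mathrm{Mod}(\Sigma)\to\mathbf{Set}$ and, for each $\varphi:\Sigma\to\Sigma'$, functions $[\![M']\!]_\varphi:[\![M']\!]_{\Sigma'}\to[\![\mathrm{Mod}(\varphi)M']\!]_\Sigma$, natural in $M'$, with $[\![M]\!]_{1_\Sigma}$ the identity and $[\![M'']\!]_{\varphi;\varphi'}=[\![M'']\!]_{\varphi'};[\![\mathrm{Mod}(\varphi')M'']\!]_\varphi$; and relations $M\models^w_\Sigma\rho$ ($w\in[\![M]\!]_\Sigma$) with $\mathrm{Mod}(\varphi)M'\models_\Sigma^{[\![M']\!]_\varphi w}\rho$ iff $M'\models_{\Sigma'}^w\mathrm{Sen}(\varphi)\rho$. Standing assumption: in all considered stratified institutions satisfaction is preserved by model isomorphisms ($M\models^w\rho$ iff $N\models^{[\![h]\!]w}\rho$ for an isomorphism $h:M\to N$). **Stratified institution morphisms.** A stratified institution morphism $(\Phi,\alpha,\beta):\mathcal{S}'\to\mathcal{S}$ consists of a functor $\Phi:\mathrm{Sign}'\to\mathrm{Sign}$,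 a natural transformation $\alpha:\Phi;\mathrm{Sen}\Rightarrow\mathrm{Sen}'$ and a lax natural transformation $\beta:\mathrm{Mod}'\Rightarrow\Phi^{\mathrm{op}};\mathrm{Mod}$ (functors $\beta_\Sigma:\mathrm{Mod}'(\Sigma)\to\mathrm{Mod}(\Phi\Sigma)$ together with, for each $\varphi:\Sigma\to\Omega$ in $\mathrm{Sign}'$, homomorphisms $\beta_{\varphi,M}:\mathrm{Mod}(\Phi\varphi)(\beta_\Omega M)\to\beta_\Sigma(\mathrm{Mod}'(\varphi)M)$ natural in the $\Omega$-model $M$ and compatible with identities and composition of signature morphisms) such that $\beta_\Sigma;[\![\_]\!]_{\Phi\Sigma}=[\![\_]\!]'_\Sigma$ as functors, $[\![\beta_\Omega M]\!]_{\Phi\varphi};[\![\beta_{\varphi,M}]\!]_{\Phi\Sigma}=[\![M]\!]'_\varphi$, and, for every $\Sigma$-model $M'$, $w\in[\![M']\!]'_\Sigma$ and $\Phi(\Sigma)$-sentence $\rho$, $M'\models^{w}\alpha_\Sigma\rho$ iff $\beta_\Sigma M'\models^{w}\rho$. It is strict when $\beta$ is strict (all $\beta_{\varphi,M}$ are identities). **Local and global institutions.** $\mathcal{S}^\sharp$ has the signatures and sentences of $\mathcal S$; its $\Sigma$-models are pairs $(M,w)$ with $w\in[\![M]\!]_\Sigma$; homomorphisms $(M,w)\to(N,v)$ are pairs $(h,w)$ with $h:M\to N$, $[\![h]\!]_\Sigma w=v$; $\mathrm{Mod}^\sharp(\varphi)(M',w')=(\mathrm{Mod}(\varphi)M',[\![M']\!]_\varphi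 w')$; $(M,w)\models^\sharp\rho$ iff $M\models^w\rho$. $\mathcal S^*$ has the signatures, sentences and models of $\mathcal S$, and $M\models^*\rho$ iff $M\models^w\rho$ for all $w\in[\![M]\!]_\Sigma$; whenever $\mathcal S^*$ is invoked (for any stratified institution), all functions $[\![M']\!]_\varphi$ are tacitly assumed surjective. **The stratified institution $\widetilde{\mathcal{B}}$** of an institution $\mathcal{B}$: same signatures and sentences as $\mathcal{B}$; $\Sigma$-models are pairs $(W,B)$ with $W$ a set and $B:W\to|\mathrm{Mod}^{\mathcal B}(\Sigma)|$ (write $B^w$ for $B(w)$); homomorphisms $(W,B)\to(V,N)$ are $h=(h_0:W\to V,(h^w:B^w\to N^{h_0w})_{w\in W})$; reducts are componentwise with the same $W$; $[\![(W,B)]\!]=W$, $[\![h]\!]=h_0$, all $[\![\_]\!]_\varphi$ identities; $(W,B)\models^w\rho$ iff $B^w\models^{\mathcal B}\rho$. **Decompositions.** A base for $\mathcal{S}$ is an institution morphism $(\Phi,\alpha,\beta):\mathcal{S}^\sharp\to\mathcal{B}$. The stratified institution morphism $(\Phi,\alpha,\widetilde\beta):\mathcal S\to\widetilde{\mathcal B}$ corresponding to it is given by $\widetilde\beta_\Sigma M=([\![M]\!]_\Sigma,(\beta_\Sigma(M,w))_{w\in[\![M]\!]_\Sigma})$ and $\widetilde\beta_\Sigma h=([\![h]\!]_\Sigma,(\beta_\Sigma(h,w))_w)$; it is strict. A constraint model sub-functor is a sub-functor $\mathrm{Mod}^C\subseteq\mathrm{Mod}^{\widetilde{\mathcal B}}$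 with $\widetilde\beta_\Sigma(\mathrm{Mod}^{\mathcal S}(\Sigma))\subseteq\mathrm{Mod}^C(\Phi\Sigma)$ for each $\Sigma$; $\widetilde{\mathcal B}^C$ is the stratified sub-institution of $\widetilde{\mathcal B}$ induced by $\mathrm{Mod}^C$. Given a base and a constraint model sub-functor, a decomposition of $\mathcal S$ consists of two stratified institution morphisms $(\Phi^0,\alpha^0,\beta^0):\mathcal S\to\mathcal S^0$ and $(\Phi,\alpha,\widetilde\beta):\mathcal S\to\widetilde{\mathcal B}^C$ such that for each $\mathcal S$-signature $\Sigma$ the functors $\beta^0_\Sigma$ and $\widetilde\beta_\Sigma$ form a pullback in $\mathbf{CAT}$ of $[\![\_]\!]^0_{\Phi^0\Sigma}:\mathrm{Mod}^0(\Phi^0\Sigma)\to\mathbf{Set}$ and $[\![\_]\!]_{\Phi\Sigma}:\mathrm{Mod}^C(\Phi\Sigma)\to\mathbf{Set}$. **Diagrams.** An institution has diagrams when for each signature $\Sigma$ and $\Sigma$-model $M$ there exist a signature $\Sigma_M$ and a signature morphism $\iota_{\Sigma,M}:\Sigma\to\Sigma_M$ (functorial in $\Sigma$ and $M$), a set $E_M$ of $\Sigma_M$-sentences, and an isomorphism of categories $i_{\Sigma,M}:\mathrm{Mod}(\Sigma_M,E_M)\to M/\mathrm{Mod}(\Sigma)$ (natural in $\Sigma$ and $M$), where $\mathrm{Mod}(\Sigma_M,E_M)$ is the full subcategory of $\mathrm{Mod}(\Sigma_M)$ of models satisfying $E_M$ and $M/\mathrm{Mod}(\Sigma)$ is the comma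 category, such that the composite of $i_{\Sigma,M}$ with the forgetful functor $M/\mathrm{Mod}(\Sigma)\to\mathrm{Mod}(\Sigma)$ is the restriction of $\mathrm{Mod}(\iota_{\Sigma,M})$. Convention: the functoriality of $\iota$ and the naturality of $i$ are ignored in the result, which concerns only the primary property (that $i_{\Sigma,M}$ is an isomorphism making the triangle commute). **Coherence.** A system of diagrams for $\mathcal B$ is coherent with respect to $\mathrm{Mod}^C$ when for each $\mathcal B$-signature $\Sigma$ and each $(W,B)\in|\mathrm{Mod}^C(\Sigma)|$: (1) for all $i,j\in W$, $\iota_{\Sigma,B^i}=\iota_{\Sigma,B^j}$; in this case all $\iota_{\Sigma,B^i}$ are denoted by $\iota_{\Sigma,B}:\Sigma\to\Sigma_B$; (2) there exists a canonical isomorphism $i_{\Sigma,(W,B)}:\mathrm{Mod}(\Sigma_B,E_{(W,B)})\to(W,B)/\mathrm{Mod}^C(\Sigma)$ commuting with the functors to $\mathrm{Mod}^C(\Sigma)$, namely the one induced by $\mathrm{Mod}^C(\iota_{\Sigma,B})$ and the forgetful one, respectively. Here $\mathrm{Mod}(\Sigma_B,E_{(W,B)})$ denotes the subcategory of the comma category $W/[\![\_]\!]_{\Sigma_B}$ (with $[\![\_]\!]_{\Sigma_B}:\mathrm{Mod}^C(\Sigma_B)\to\mathbf{Set}$) induced by those objects $(f:W\to V,(V,N'))$ such that $N'^{f(i)}\models E_{B^i}$ for each $i\in W$. The decomposition admits diagrams when $(\mathcal S^0)^*$ and $\mathcal B$ have diagrams such that the diagrams of $\mathcal B$ are coherent with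 respect to $\mathrm{Mod}^C$. **Nominals.** $\mathrm{SETC}$: a signature is a set $C$ of constants; a $C$-model is a set with an interpretation of each $c\in C$ as an element; homomorphisms are constant-preserving functions; reducts keep the underlying set. A nominals extraction for $\mathcal S$ is a functor $N:\mathrm{Sign}^{\mathcal S}\to\mathrm{Sign}^{\mathrm{SETC}}$ (signatures of $\mathrm{SETC}$ being sets) together with a lax natural transformation $\mathrm{Nm}:\mathrm{Mod}^{\mathcal S}\Rightarrow N;\mathrm{Mod}^{\mathrm{SETC}}$ whose composite with the underlying-set functors is $[\![\_]\!]$; i.e. functors $\mathrm{Nm}_\Sigma:\mathrm{Mod}^{\mathcal S}(\Sigma)\to\mathrm{Mod}^{\mathrm{SETC}}(N(\Sigma))$ whose composites with the underlying set functor are $[\![\_]\!]_\Sigma$, such that for $\varphi:\Sigma\to\Sigma'$ the function $[\![M']\!]_\varphi$ is a $\mathrm{SETC}$-homomorphism from the $N(\varphi)$-reduct of $\mathrm{Nm}_{\Sigma'}(M')$ to $\mathrm{Nm}_\Sigma(\mathrm{Mod}(\varphi)M')$. For $i\in N(\Sigma)$, an $i$-sentence is a $\Sigma$-sentence $i\text{-sen}$ with $M\models^w i\text{-sen}$ iff $(\mathrm{Nm}_\Sigma(M))_i=w$; the satisfaction of $\rho$ at $i$ is a $\Sigma$-sentence $@_i\rho$ with $M\models^w@_i\rho$ iff $M\models^{(\mathrm{Nm}_\Sigma(M))_i}\rho$ (for every $\Sigma$-model $M$ and $w\in[\![M]\!]_\Sigma$). $\mathcal S$ has explicit local satisfaction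 when $@_i\rho$ exists for all $\Sigma$, $\rho\in\mathrm{Sen}(\Sigma)$, $i\in N(\Sigma)$; it has $i$-sentences when $i\text{-sen}$ exists for all $\Sigma$ and $i\in N(\Sigma)$. **Denoting the stratification.** For an $\mathcal S$-signature $\Sigma$ and $\Sigma$-model $M$ put $\Sigma_0=\Phi^0\Sigma$, $\Sigma_1=\Phi\Sigma$, $M_0=\beta^0_\Sigma M$, $M_1=\widetilde\beta_\Sigma M$. The diagrams of the decomposition denote the stratification when: (a) $\mathrm{Sign}^0\xleftarrow{\Phi^0}\mathrm{Sign}^{\mathcal S}\xrightarrow{\Phi}\mathrm{Sign}^{\mathcal B}$ is a product in $\mathbf{CAT}$; then $\iota_{\Sigma,M}:\Sigma\to\Sigma_M$ denotes the morphism $(\iota_{\Sigma_0,M_0},\iota_{\Sigma_1,M_1})$ of $\mathrm{Sign}^{\mathcal S}$ given by the product property; (b) $\mathcal S$ has a nominals extraction $(N,\mathrm{Nm})$; (c) for each $\Sigma$ and each $\Sigma$-model $M$ there exists a function $n_{\Sigma,M}:[\![M]\!]_\Sigma\to N(\Sigma_M)$ such that $n$ is natural in $\Sigma$ and $M$; and (d) for each $\Sigma_M$-model $K$ with $K\models\alpha^0_{\Sigma_M}E_{M_0}$ (satisfaction at all states of $K$), writing $K_0=\beta^0_{\Sigma_M}K$, one has $(\mathrm{Nm}_{\Sigma_M}(K))_{n_{\Sigma,M}(a)}=[\![i_{\Sigma_0,M_0}K_0]\!]_{\Sigma_0}(a)$ for all $a\in[\![M]\!]_\Sigma$.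
   Formalization: Added assumptions, without which the claim fails: the stratification functions of S^0 are identities (those of S too, as strictness of β̃ implies), β^0 is strict, and, in (ii), for each sentence of α^0E_{M_0} its satisfaction at all states is expressed by a sentence. *)

(* Defs.v *)
From Stdlib Require Import FunctionalExtensionality ProofIrrelevance Eqdep JMeq.

Set Implicit Arguments.
Unset Strict Implicit.
Unset Printing Implicit Defensive.

Record Category := {
  Ob :> Type;
  Hom : Ob -> Ob -> Type;
  idm : forall a, Hom a a;
  comp : forall x y z, Hom x y -> Hom y z -> Hom x z;
  comp_id_l : forall a b (f : Hom a b), comp (idm a) f = f;
  comp_id_r : forall a b (f : Hom a b), comp f (idm b) = f;
  comp_assoc : forall a b c d (f : Hom a b) (g : Hom b c) (h : Hom c d),
    comp f (comp g h) = comp (comp f g) h }.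

Arguments Hom {_} _ _.
Arguments idm {_} a.
Arguments comp {_ _ _ _} _ _.
(** Diagrammatic order. *)
Notation "f ;; g" := (comp f g) (at level 50, left associativity).

(** [arrow f = arrow g] is the equality of two arrows together with their
    endpoints; it makes sense when the endpoints are only provably equal. *)
Record Arrow (C : Category) := arrow { dom : C; cod : C; hom_of : Hom dom cod }.
Arguments arrow {C dom cod} hom_of.

Record Functor (C D : Category) := {
  fob :> C -> D;
  fmap : forall a b, Hom a b -> Hom (fob a) (fob b);
  fmap_id : forall a, fmap (idm a) = idm (fob a);
  fmap_comp : forall a b c (f : Hom a b) (g : Hom b c),
    fmap (f ;; g) = fmap f ;; fmap g }.
Arguments fmap {_ _} _ {_ _} _.

Definition IdF (C : Category) : Functor C C :=
  {| fob := fun x => x; fmap := fun _ _ f => f;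
     fmap_id := fun _ => eq_refl; fmap_comp := fun _ _ _ _ _ => eq_refl |}.

Definition compF (C D E : Category) (F : Functor C D) (G : Functor D E) :
  Functor C E.
Proof.
  refine {| fob := fun x => G (F x); fmap := fun _ _ f => fmap G (fmap F f) |}.
  - intros; now rewrite !fmap_id.
  - intros; now rewrite !fmap_comp.
Defined.

Definition SetCat : Category.
Proof.
  refine {| Ob := Type; Hom := fun A B => A -> B; idm := fun A x => x;
            comp := fun _ _ _ f g x => g (f x) |}; reflexivity.
Defined.

Definition cast (A B : Type) (e : A = B) (a : A) : B :=
  match e in _ = X return X with eq_refl => a end.

Definition eq_fob (C D : Category) (F G : Functor C D) (e : F = G) (x : C) :
  F x = G x := f_equal (fun H : Functor C D => H x) e.

Definition eq_hom (C : Category) (a b : C) (e : a = b) : Hom a b :=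
  match e in _ = x return Hom a x with eq_refl => idm a end.

Lemma arrow_inj (C : Category) (a b : C) (f g : Hom a b) :
  arrow f = arrow g -> f = g.
Proof.
  intro H. injection H as H. apply inj_pair2 in H. now apply inj_pair2 in H.
Qed.

Lemma arrow_eq_hom (C : Category) (a b : C) (e : a = b) :
  arrow (eq_hom e) = arrow (idm b).
Proof. now destruct e. Qed.

Lemma arrow_eq_hom_l (C : Category) (a b c : C) (e : a = b) (f : Hom b c) :
  arrow (eq_hom e ;; f) = arrow f.
Proof. destruct e; simpl; now rewrite comp_id_l. Qed.

Lemma arrow_eq_hom_r (C : Category) (a b c : C) (e : b = c) (f : Hom a b) :
  arrow (f ;; eq_hom e) = arrow f.
Proof. destruct e; simpl; now rewrite comp_id_r. Qed.

Lemma fmap_arrow (C D : Category) (F : Functor C D) (a b a' b' : C)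
  (f : Hom a b) (g : Hom a' b') :
  arrow f = arrow g -> arrow (fmap F f) = arrow (fmap F g).
Proof.
  intro H.
  exact (f_equal (fun u : Arrow C => arrow (fmap F (hom_of u))) H).
Qed.

Lemma functor_ext (C D : Category) (F G : Functor C D) :
  (forall x, F x = G x) ->
  (forall x y (f : Hom x y), arrow (fmap F f) = arrow (fmap G f)) -> F = G.
Proof.
  destruct F as [Fo Fm Fi Fc], G as [Go Gm Gi Gc]; simpl; intros Ho Hm.
  assert (E : Fo = Go) by now apply functional_extensionality.
  subst Go.
  assert (E : Fm = Gm).
  { extensionality a; extensionality b; extensionality f.
    apply arrow_inj, Hm. }
  subst Gm. f_equal; apply proof_irrelevance.
Qed.

Record CatIso (C D : Category) := {
  iso_fun :> Functor C D;
  iso_inv : Functor D C;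
  iso_fun_inv : compF iso_fun iso_inv = IdF C;
  iso_inv_fun : compF iso_inv iso_fun = IdF D }.

Definition is_iso (C : Category) (a b : C) (f : Hom a b) : Prop :=
  exists g : Hom b a, f ;; g = idm a /\ g ;; f = idm b.

Definition is_pullback (P A B D : Category) (p : Functor P A) (q : Functor P B)
  (f : Functor A D) (g : Functor B D) : Prop :=
  compF p f = compF q g /\
  forall (X : Category) (a : Functor X A) (b : Functor X B),
    compF a f = compF b g ->
    exists! u : Functor X P, compF u p = a /\ compF u q = b.

Definition is_product (P A B : Category) (p : Functor P A) (q : Functor P B) :
  Prop :=
  forall (X : Category) (a : Functor X A) (b : Functor X B),
    exists! u : Functor X P, compF u p = a /\ compF u q = b.

Definition FullSub (C : Category) (P : C -> Prop) : Category.
Proof.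
  refine {| Ob := {x : C | P x};
            Hom := fun x y => Hom (proj1_sig x) (proj1_sig y);
            idm := fun x => idm (proj1_sig x);
            comp := fun _ _ _ f g => f ;; g |}; intros.
  - apply comp_id_l.
  - apply comp_id_r.
  - apply comp_assoc.
Defined.

Definition full_ob (C : Category) (P : C -> Prop) (x : C) (H : P x) :
  FullSub P := exist P x H.
Arguments full_ob {_ _} _ _.

Definition full_incl (C : Category) (P : C -> Prop) : Functor (FullSub P) C.
Proof.
  refine (@Build_Functor (FullSub P) C (fun x => proj1_sig x)
            (fun _ _ f => f) _ _); reflexivity.
Defined.

(** The values of [sub_hom] outside [sub_ob] are irrelevant. *)
Record SubCategory (C : Category) := {
  sub_ob : C -> Prop;
  sub_hom : forall a b : C, Hom a b -> Prop;
  sub_id : forall a, sub_ob a -> sub_hom (idm a);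
  sub_comp : forall a b c (f : Hom a b) (g : Hom b c),
    sub_hom f -> sub_hom g -> sub_hom (f ;; g) }.
Arguments sub_hom {_} _ {_ _} _.

Lemma sig_ext (A : Type) (P : A -> Prop) (x y : {a | P a}) :
  proj1_sig x = proj1_sig y -> x = y.
Proof.
  destruct x, y; simpl; intro; subst; f_equal; apply proof_irrelevance.
Qed.

Definition subcat (C : Category) (S : SubCategory C) : Category.
Proof.
  refine {| Ob := {x : C | sub_ob S x};
            Hom := fun x y =>
              {f : Hom (proj1_sig x) (proj1_sig y) | sub_hom S f};
            idm := fun x => exist _ (idm (proj1_sig x)) (sub_id (proj2_sig x));
            comp := fun _ _ _ f g =>
              exist _ (proj1_sig f ;; proj1_sig g)
                (sub_comp (proj2_sig f) (proj2_sig g)) |};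
  intros; apply sig_ext; simpl.
  - apply comp_id_l.
  - apply comp_id_r.
  - apply comp_assoc.
Defined.

Definition subcat_incl (C : Category) (S : SubCategory C) :
  Functor (subcat S) C.
Proof.
  refine (@Build_Functor (subcat S) C (fun x => proj1_sig x)
            (fun _ _ f => proj1_sig f) _ _); reflexivity.
Defined.

Lemma subcat_arrow (C : Category) (S : SubCategory C) (a b a' b' : subcat S)
  (f : Hom a b) (g : Hom a' b') :
  arrow (proj1_sig f) = arrow (proj1_sig g) -> arrow f = arrow g.
Proof.
  destruct a as [a Ha], b as [b Hb], a' as [a' Ha'], b' as [b' Hb'].
  destruct f as [f Hf], g as [g Hg]; simpl in *. intro H.
  assert (Ea : a = a') by exact (f_equal (@dom C) H).
  assert (Eb : b = b') by exact (f_equal (@cod C) H).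
  subst a' b'. apply arrow_inj in H. subst g.
  rewrite (proof_irrelevance _ Ha' Ha), (proof_irrelevance _ Hb' Hb),
    (proof_irrelevance _ Hg Hf). reflexivity.
Qed.

Definition subcat_lift (C D : Category) (S : SubCategory D) (F : Functor C D)
  (Ho : forall x, sub_ob S (F x))
  (Hh : forall x y (f : Hom x y), sub_hom S (fmap F f)) :
  Functor C (subcat S).
Proof.
  refine (@Build_Functor C (subcat S) (fun x => exist _ (F x) (Ho x))
            (fun _ _ f => exist _ (fmap F f) (Hh _ _ f)) _ _);
  intros; apply sig_ext; simpl.
  - apply fmap_id.
  - apply fmap_comp.
Defined.

Definition subcat_map (C D : Category) (S : SubCategory C) (T : SubCategory D)
  (F : Functor C D) (Ho : forall x, sub_ob S x -> sub_ob T (F x))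
  (Hh : forall x y (f : Hom x y), sub_hom S f -> sub_hom T (fmap F f)) :
  Functor (subcat S) (subcat T).
Proof.
  refine (@Build_Functor (subcat S) (subcat T)
            (fun x => exist _ (F (proj1_sig x)) (Ho _ (proj2_sig x)))
            (fun _ _ f => exist _ (fmap F (proj1_sig f)) (Hh _ _ _ (proj2_sig f)))
            _ _);
  intros; apply sig_ext; simpl.
  - apply fmap_id.
  - apply fmap_comp.
Defined.

Record CommaOb (C D : Category) (X : D) (F : Functor C D) := mkComma {
  co_ob : C;
  co_map : Hom X (F co_ob) }.
Arguments mkComma {C D X F} co_ob co_map.
Arguments co_ob {C D X F} _.
Arguments co_map {C D X F} _.

Definition comma (C D : Category) (X : D) (F : Functor C D) : Category.
Proof.
  unshelve refine {| Ob := CommaOb X F;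
    Hom := fun x y => {u : Hom (co_ob x) (co_ob y) | co_map x ;; fmap F u = co_map y};
    idm := fun x => exist _ (idm (co_ob x)) _;
    comp := fun _ _ _ f g => exist _ (proj1_sig f ;; proj1_sig g) _ |}.
  - cbn. now rewrite fmap_id, comp_id_r.
  - cbn. destruct f as [f Hf], g as [g Hg]; cbn.
    now rewrite fmap_comp, comp_assoc, Hf.
  - intros; apply sig_ext, comp_id_l.
  - intros; apply sig_ext, comp_id_r.
  - intros; apply sig_ext, comp_assoc.
Defined.

Definition comma_proj (C D : Category) (X : D) (F : Functor C D) :
  Functor (comma X F) C.
Proof.
  refine (@Build_Functor (comma X F) C (fun x => co_ob x)
            (fun _ _ f => proj1_sig f) _ _); reflexivity.
Defined.

Definition coslice (C : Category) (X : C) : Category := comma X (IdF C).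

Definition coslice_forget (C : Category) (X : C) : Functor (coslice X) C :=
  comma_proj X (IdF C).

Definition Ext (C : Category) (a : C) : Type := {b : C & Hom a b}.
Definition ext_cod (C : Category) (a : C) (x : Ext a) : C := projT1 x.
Definition ext_hom (C : Category) (a : C) (x : Ext a) : Hom a (ext_cod x) :=
  projT2 x.
Definition map_ext (C D : Category) (F : Functor C D) (a : C) (x : Ext a) :
  Ext (F a) := existT _ (F (ext_cod x)) (fmap F (ext_hom x)).

(** A functor [Sign^op -> CAT], spelled out to avoid a category of
    categories. *)
Record IndexedCat (Sign : Category) := {
  mod_ob :> Sign -> Category;
  red : forall s s' : Sign, Hom s s' -> Functor (mod_ob s') (mod_ob s);
  red_id : forall s, red (idm s) = IdF (mod_ob s);
  red_comp : forall s s' s'' (f : Hom s s') (g : Hom s' s''),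
    red (f ;; g) = compF (red g) (red f) }.
Arguments red {_} _ {_ _} _.

Record Institution := {
  Sign : Category;
  Sen : Functor Sign SetCat;
  Mod : IndexedCat Sign;
  sat : forall s : Sign, Mod s -> Sen s -> Prop;
  sat_cond : forall (s s' : Sign) (f : Hom s s') (M' : Mod s') (r : Sen s),
    sat M' (fmap Sen f r) <-> sat (red Mod f M') r }.

Record InstMor (I2 I1 : Institution) := {
  im_sign : Functor (Sign I2) (Sign I1);
  im_sen : forall s : Sign I2, Sen I1 (im_sign s) -> Sen I2 s;
  im_sen_nat : forall (s s' : Sign I2) (f : Hom s s') (r : Sen I1 (im_sign s)),
    im_sen (fmap (Sen I1) (fmap im_sign f) r) = fmap (Sen I2) f (im_sen r);
  im_mod : forall s : Sign I2, Functor (Mod I2 s) (Mod I1 (im_sign s));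
  im_mod_nat : forall (s s' : Sign I2) (f : Hom s s'),
    compF (im_mod s') (red (Mod I1) (fmap im_sign f))
    = compF (red (Mod I2) f) (im_mod s);
  im_sat : forall (s : Sign I2) (M : Mod I2 s) (r : Sen I1 (im_sign s)),
    sat M (im_sen r) <-> sat (im_mod s M) r }.
Arguments im_sen {_ _} _ _ _.
Arguments im_sen_nat {_ _} _ {_ _} _ _.
Arguments im_mod_nat {_ _} _ {_ _} _.
Arguments im_sat {_ _} _ {_} _ _.

Record StratInst := {
  SSign : Category;
  SSen : Functor SSign SetCat;
  SMod : IndexedCat SSign;
  strat : forall s : SSign, Functor (SMod s) SetCat;
  strat_red : forall (s s' : SSign) (f : Hom s s') (M' : SMod s'),
    strat s' M' -> strat s (red SMod f M');
  strat_red_nat : forall (s s' : SSign) (f : Hom s s') (M' N' : SMod s')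
    (h : Hom M' N') (w : strat s' M'),
    strat_red f (fmap (strat s') h w)
    = fmap (strat s) (fmap (red SMod f) h) (strat_red f w);
  strat_red_id : forall (s : SSign) (M : SMod s),
    @arrow SetCat _ _ (@strat_red s s (idm s) M)
    = arrow (@idm SetCat (strat s M));
  strat_red_comp : forall (s s' s'' : SSign) (f : Hom s s') (g : Hom s' s'')
    (M : SMod s''),
    @arrow SetCat _ _ (@strat_red s s'' (f ;; g) M)
    = @arrow SetCat _ _
        (@comp SetCat _ _ _ (@strat_red s' s'' g M)
           (@strat_red s s' f (red SMod g M)));
  ssat : forall (s : SSign) (M : SMod s), strat s M -> SSen s -> Prop;
  ssat_cond : forall (s s' : SSign) (f : Hom s s') (M' : SMod s')
    (w : strat s' M') (r : SSen s),
    ssat (strat_red f w) r <-> ssat w (fmap SSen f r) }.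
Arguments strat_red _ {_ _} _ _ _.
Arguments ssat _ {_} _ _ _.
Arguments strat : clear implicits.

Definition iso_invariant (S : StratInst) : Prop :=
  forall (s : SSign S) (M N : SMod S s) (h : Hom M N), is_iso h ->
  forall (w : strat S s M) (r : SSen S s),
    ssat S M w r <-> ssat S N (fmap (strat S s) h w) r.

Definition surjective_stratification (S : StratInst) : Prop :=
  forall (s s' : SSign S) (f : Hom s s') (M' : SMod S s')
    (v : strat S s (red (SMod S) f M')),
    exists w : strat S s' M', strat_red S f M' w = v.

Definition strict_stratification (S : StratInst) : Prop :=
  forall (s s' : SSign S) (f : Hom s s') (M' : SMod S s'),
    @arrow SetCat _ _ (strat_red S f M')
    = arrow (@idm SetCat (strat S s' M')).

Record StratMor (S' S : StratInst) := {
  sm_sign : Functor (SSign S') (SSign S);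
  sm_sen : forall s : SSign S', SSen S (sm_sign s) -> SSen S' s;
  sm_sen_nat : forall (s s' : SSign S') (f : Hom s s')
    (r : SSen S (sm_sign s)),
    sm_sen (fmap (SSen S) (fmap sm_sign f) r) = fmap (SSen S') f (sm_sen r);
  sm_mod : forall s : SSign S', Functor (SMod S' s) (SMod S (sm_sign s));
  sm_lax : forall (s o : SSign S') (f : Hom s o) (M : SMod S' o),
    Hom (red (SMod S) (fmap sm_sign f) (sm_mod o M))
        (sm_mod s (red (SMod S') f M));
  sm_lax_nat : forall (s o : SSign S') (f : Hom s o) (M N : SMod S' o)
    (h : Hom M N),
    sm_lax f M ;; fmap (sm_mod s) (fmap (red (SMod S') f) h)
    = fmap (red (SMod S) (fmap sm_sign f)) (fmap (sm_mod o) h) ;; sm_lax f N;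
  sm_lax_id : forall (s : SSign S') (M : SMod S' s),
    arrow (sm_lax (idm s) M) = arrow (idm (sm_mod s M));
  sm_lax_comp : forall (s s' s'' : SSign S') (f : Hom s s') (g : Hom s' s'')
    (M : SMod S' s''),
    arrow (sm_lax (f ;; g) M)
    = arrow (fmap (red (SMod S) (fmap sm_sign f)) (sm_lax g M)
             ;; sm_lax f (red (SMod S') g M));
  sm_strat : forall s : SSign S',
    compF (sm_mod s) (strat S (sm_sign s)) = strat S' s;
  sm_strat_red : forall (s o : SSign S') (f : Hom s o) (M : SMod S' o),
    @arrow SetCat _ _
      (@comp SetCat _ _ _ (strat_red S (fmap sm_sign f) (sm_mod o M))
         (fmap (strat S (sm_sign s)) (sm_lax f M)))
    = @arrow SetCat _ _ (strat_red S' f M);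
  sm_sat : forall (s : SSign S') (M : SMod S' s) (w : strat S' s M)
    (r : SSen S (sm_sign s)),
    ssat S' M w (sm_sen r)
    <-> ssat S (sm_mod s M) (cast (eq_sym (eq_fob (sm_strat s) M)) w) r }.

Arguments sm_sen {_ _} _ _ _.
Arguments sm_lax {_ _} _ {_ _} _ _.
Arguments sm_sen_nat {_ _} _ {_ _} _ _.
Arguments sm_sat {_ _} _ {_} _ _ _.

Definition is_strict (S' S : StratInst) (m : StratMor S' S) : Prop :=
  forall (s o : SSign S') (f : Hom s o) (M : SMod S' o),
    arrow (sm_lax m f M) = arrow (idm (sm_mod m s (red (SMod S') f M))).

Definition star (S : StratInst) (Hs : surjective_stratification S) :
  Institution.
Proof.
  refine {| Sign := SSign S; Sen := SSen S; Mod := SMod S;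
            sat := fun s M r => forall w : strat S s M, ssat S M w r |}.
  intros s s' f M' r; split; intros H w.
  - destruct (Hs s s' f M' w) as [w' <-]. now apply ssat_cond.
  - apply ssat_cond, H.
Defined.

Section Sharp.
Variable S : StratInst.

Record SharpOb (s : SSign S) := mkSharp {
  sh_mod : SMod S s;
  sh_pt : strat S s sh_mod }.
Arguments mkSharp {s} sh_mod sh_pt.

Definition SharpHom (s : SSign S) (X Y : SharpOb s) : Type :=
  {h : Hom (sh_mod X) (sh_mod Y) | fmap (strat S s) h (sh_pt X) = sh_pt Y}.

Definition SharpCat (s : SSign S) : Category.
Proof.
  unshelve refine {| Ob := SharpOb s; Hom := @SharpHom s;
    idm := fun X => exist _ (idm (sh_mod X)) _;
    comp := fun _ _ _ f g => exist _ (proj1_sig f ;; proj1_sig g) _ |}.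
  - now rewrite fmap_id.
  - destruct f as [f Hf], g as [g Hg]; cbn.
    rewrite fmap_comp; cbn. now rewrite Hf.
  - intros; apply sig_ext, comp_id_l.
  - intros; apply sig_ext, comp_id_r.
  - intros; apply sig_ext, comp_assoc.
Defined.

Lemma sharp_ob_eq (s : SSign S) (M N : SMod S s) (v : strat S s M)
  (w : strat S s N) :
  M = N -> JMeq v w -> mkSharp M v = mkSharp N w.
Proof. intros ->. intro H. now apply JMeq_eq in H; subst. Qed.

Lemma sharp_arrow (s : SSign S) (X Y X' Y' : SharpCat s) (f : Hom X Y)
  (g : Hom X' Y') :
  X = X' -> Y = Y' -> arrow (proj1_sig f) = arrow (proj1_sig g) ->
  arrow f = arrow g.
Proof.
  intros; subst. f_equal. apply sig_ext. now apply arrow_inj.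
Qed.

Definition sharp_red (s s' : SSign S) (f : Hom s s') :
  Functor (SharpCat s') (SharpCat s).
Proof.
  unshelve refine (@Build_Functor (SharpCat s') (SharpCat s)
    (fun X => mkSharp (red (SMod S) f (sh_mod X)) (strat_red S f (sh_mod X) (sh_pt X)))
    (fun X Y h => exist _ (fmap (red (SMod S) f) (proj1_sig h)) _) _ _).
  - destruct h as [h Hh]; cbn. now rewrite <- strat_red_nat, Hh.
  - intros; apply sig_ext, fmap_id.
  - intros; apply sig_ext, fmap_comp.
Defined.

Lemma set_arrow_JMeq (A B A' B' : Type) (f : A -> B) (g : A' -> B') (x : A)
  (y : A') :
  @arrow SetCat A B f = @arrow SetCat A' B' g -> JMeq x y ->
  JMeq (f x) (g y).
Proof.
  intros H. assert (EA : A = A') by exact (f_equal (@dom SetCat) H).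
  assert (EB : B = B') by exact (f_equal (@cod SetCat) H).
  subst A' B'. apply arrow_inj in H. subst g.
  intro E. now apply JMeq_eq in E; subst.
Qed.

Definition SharpMod : IndexedCat (SSign S).
Proof.
  refine {| mod_ob := SharpCat; red := sharp_red |}.
  - intro s.
    assert (Ho : forall X, sharp_red (idm s) X = IdF (SharpCat s) X).
    { intros [M w]; cbn. apply sharp_ob_eq.
      - exact (eq_fob (red_id (SMod S) s) M).
      - exact (set_arrow_JMeq (strat_red_id M) (JMeq_refl w)). }
    apply functor_ext; [exact Ho|]. intros X Y h.
    apply sharp_arrow; [apply Ho|apply Ho|]. cbn.
    now rewrite (red_id (SMod S) s).
  - intros s s' s'' f g.
    assert (Ho : forall X, sharp_red (f ;; g) X
                           = compF (sharp_red g) (sharp_red f) X).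
    { intros [M w]; cbn. apply sharp_ob_eq.
      - exact (eq_fob (red_comp (SMod S) f g) M).
      - exact (set_arrow_JMeq (strat_red_comp f g M) (JMeq_refl w)). }
    apply functor_ext; [exact Ho|]. intros X Y h.
    apply sharp_arrow; [apply Ho|apply Ho|]. cbn.
    now rewrite (red_comp (SMod S) f g).
Defined.

Definition sharp : Institution.
Proof.
  refine {| Sign := SSign S; Sen := SSen S; Mod := SharpMod;
            sat := fun s (X : SharpCat s) r => ssat S (sh_mod X) (sh_pt X) r |}.
  intros s s' f M' r; cbn; apply iff_sym, ssat_cond.
Defined.

End Sharp.

Arguments mkSharp {_ _} _ _.

Section Fam.
Variable C : Category.

Record FamOb := mkFam { idx : Type; fib : idx -> C }.

Record FamHom (X Y : FamOb) := mkFamHom {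
  fh_fun : idx X -> idx Y;
  fh_hom : forall w : idx X, Hom (fib w) (fib (fh_fun w)) }.

Definition Fam : Category.
Proof.
  refine {| Ob := FamOb; Hom := FamHom;
            idm := fun X => mkFamHom (fun w => idm (fib (f := X) w));
            comp := fun X Y Z h k =>
              mkFamHom (Y := Z) (fh_fun := fun w => fh_fun k (fh_fun h w))
                (fun w => fh_hom h w ;; fh_hom k (fh_fun h w)) |}.
  - intros X Y [h0 h]; cbn. f_equal. extensionality w. apply comp_id_l.
  - intros X Y [h0 h]; cbn. f_equal. extensionality w. apply comp_id_r.
  - intros; cbn. f_equal. extensionality w. apply comp_assoc.
Defined.

Definition fam_idx : Functor Fam SetCat.
Proof.
  refine (@Build_Functor Fam SetCat idx (fun X Y h => fh_fun h) _ _);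
  reflexivity.
Defined.

Lemma fam_hom_ext (X Y : FamOb) (h k : FamHom X Y) :
  (forall w, fh_fun h w = fh_fun k w) ->
  (forall w, arrow (fh_hom h w) = arrow (fh_hom k w)) -> h = k.
Proof.
  destruct h as [h0 h], k as [k0 k]; cbn. intros E0 E.
  assert (e : h0 = k0) by now apply functional_extensionality.
  subst k0. f_equal. extensionality w. apply arrow_inj, E.
Qed.

End Fam.

Arguments mkFam {_ _} _.
Arguments idx {_} _.
Arguments fib {_} _ _.
Arguments mkFamHom {_ _ _} _ _.
Arguments fh_fun {_ _ _} _ _.
Arguments fh_hom {_ _ _} _ _.

Definition Fam_map (C D : Category) (F : Functor C D) : Functor (Fam C) (Fam D).
Proof.
  refine (@Build_Functor (Fam C) (Fam D)
    (fun X => mkFam (fun w : idx X => F (fib X w)))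
    (fun X Y h => @mkFamHom D (mkFam (fun w : idx X => F (fib X w)))
       (mkFam (fun w : idx Y => F (fib Y w))) (fh_fun h) (fun w => fmap F (fh_hom h w)))
    _ _); intros; cbn; f_equal; extensionality w.
  - apply fmap_id.
  - apply fmap_comp.
Defined.

Definition tilde_Mod (B : Institution) : IndexedCat (Sign B).
Proof.
  refine {| mod_ob := fun s => Fam (Mod B s);
            red := fun s s' f => Fam_map (red (Mod B) f) |}.
  - intro s. rewrite red_id.
    apply functor_ext; [now intros [W X]|]. now intros [W X] [V Y] [h0 h].
  - intros s s' s'' f g. rewrite red_comp.
    now apply functor_ext.
Defined.

Definition tilde (B : Institution) : StratInst.
Proof.
  unshelve refine {|
    SSign := Sign B; SSen := Sen B; SMod := tilde_Mod B;
    strat := fun s => fam_idx (Mod B s);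
    strat_red := fun s s' f (M : Fam (Mod B s')) w => w;
    ssat := fun s (M : Fam (Mod B s)) (w : idx M) r => sat (fib M w) r |};
  try reflexivity.
  intros s s' f M' w r; cbn; apply iff_sym, sat_cond.
Defined.

Record SubMod (S : StratInst) := {
  sub :> forall s : SSign S, SubCategory (SMod S s);
  sub_red_ob : forall (s s' : SSign S) (f : Hom s s') (M : SMod S s'),
    sub_ob (sub s') M -> sub_ob (sub s) (red (SMod S) f M);
  sub_red_hom : forall (s s' : SSign S) (f : Hom s s') (M N : SMod S s')
    (h : Hom M N),
    sub_hom (sub s') h -> sub_hom (sub s) (fmap (red (SMod S) f) h) }.

Definition restrict_Mod (S : StratInst) (C : SubMod S) : IndexedCat (SSign S).
Proof.
  refine {| mod_ob := fun s => subcat (C s);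
            red := fun s s' f =>
              subcat_map (@sub_red_ob S C s s' f) (@sub_red_hom S C s s' f) |}.
  - intro s. apply functor_ext.
    + intro x; apply sig_ext; cbn. now rewrite red_id.
    + intros x y h; apply subcat_arrow; cbn. now rewrite red_id.
  - intros s s' s'' f g. apply functor_ext.
    + intro x; apply sig_ext; cbn. now rewrite red_comp.
    + intros x y h; apply subcat_arrow; cbn. now rewrite red_comp.
Defined.

Definition restrict (S : StratInst) (C : SubMod S) : StratInst.
Proof.
  unshelve refine {|
    SSign := SSign S; SSen := SSen S; SMod := restrict_Mod C;
    strat := fun s => compF (subcat_incl (C s)) (strat S s);
    strat_red := fun s s' f (M : subcat (C s')) w =>
      strat_red S f (proj1_sig M) w;
    ssat := fun s (M : subcat (C s)) w r => ssat S (proj1_sig M) w r |}.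
  - intros; cbn; apply strat_red_nat.
  - intros; cbn; apply strat_red_id.
  - intros; cbn; apply strat_red_comp.
  - intros; cbn; apply ssat_cond.
Defined.

Definition Base (S : StratInst) (B : Institution) : Type := InstMor (sharp S) B.

Section TildeBeta.
Variables (S : StratInst) (B : Institution) (b : Base S B).

Definition pt_hom (s : SSign S) (M N : SMod S s) (h : Hom M N)
  (w : strat S s M) :
  @Hom (Mod (sharp S) s) (mkSharp M w) (mkSharp N (fmap (strat S s) h w)) :=
  exist _ h eq_refl.

Lemma pt_hom_arrow (s : SSign S) (X Y : SharpCat s) (h : Hom X Y) :
  arrow (pt_hom (proj1_sig h) (sh_pt X)) = arrow h.
Proof.
  destruct X as [M w], Y as [N v], h as [h Hh]. cbn in *. now subst v.
Qed.

Definition tilde_beta (s : SSign S) :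
  Functor (SMod S s) (SMod (tilde B) (im_sign b s)).
Proof.
  refine (@Build_Functor (SMod S s) (Fam (Mod B (im_sign b s)))
    (fun M => mkFam (fun w : strat S s M => im_mod b s (mkSharp M w)))
    (fun M N h =>
       @mkFamHom _
         (mkFam (fun w : strat S s M => im_mod b s (mkSharp M w)))
         (mkFam (fun w : strat S s N => im_mod b s (mkSharp N w)))
         (fmap (strat S s) h)
         (fun w => fmap (im_mod b s) (pt_hom h w))) _ _).
  - intro M. apply fam_hom_ext; cbn.
    + intro w. now rewrite fmap_id.
    + intro w.
      exact (eq_trans
        (fmap_arrow (im_mod b s)
           (pt_hom_arrow (@idm (SharpCat s) (mkSharp M w))))
        (f_equal (fun u => arrow u) (fmap_id (im_mod b s) (mkSharp M w)))).
  - intros M N K h k. apply fam_hom_ext; cbn.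
    + intro w. now rewrite fmap_comp.
    + intro w.
      exact (eq_trans
        (fmap_arrow (im_mod b s)
           (pt_hom_arrow
              (@comp (SharpCat s) _ _ _ (pt_hom h w)
                 (pt_hom k (fmap (strat S s) h w)))))
        (f_equal (fun u => arrow u)
           (fmap_comp (im_mod b s) (pt_hom h w)
              (pt_hom k (fmap (strat S s) h w))))).
Defined.

Record ImageIn (C : SubMod (tilde B)) : Prop := {
  img_ob : forall (s : SSign S) (M : SMod S s),
    sub_ob (C (im_sign b s)) (tilde_beta s M);
  img_hom : forall (s : SSign S) (M N : SMod S s) (h : Hom M N),
    sub_hom (C (im_sign b s)) (fmap (tilde_beta s) h) }.

End TildeBeta.

Lemma mkFam_strict (C : Category) (A A' : Type) (f : A -> A') (G : A' -> C) :
  @arrow SetCat A A' f = arrow (@idm SetCat A) ->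
  mkFam (fun w => G (f w)) = mkFam G.
Proof.
  intro H. assert (E : A' = A) by exact (f_equal (@cod SetCat) H).
  subst A'. apply arrow_inj in H. now subst f.
Qed.

Lemma fam_arrow_strict (C : Category) (A A' B B' : Type) (f : A -> A')
  (g : B -> B') (X : A -> C) (X' : A' -> C) (Y : B -> C) (Y' : B' -> C)
  (h0 : A -> B) (h : forall w, Hom (X w) (Y (h0 w)))
  (k0 : A' -> B') (k : forall w, Hom (X' w) (Y' (k0 w))) :
  @arrow SetCat A A' f = arrow (@idm SetCat A) ->
  @arrow SetCat B B' g = arrow (@idm SetCat B) ->
  (forall w, X w = X' (f w)) -> (forall w, Y w = Y' (g w)) ->
  (forall w, g (h0 w) = k0 (f w)) ->
  (forall w, arrow (h w) = arrow (k (f w))) ->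
  @arrow (Fam C) (mkFam X) (mkFam Y) (@mkFamHom C (mkFam X) (mkFam Y) h0 h)
  = @arrow (Fam C) (mkFam X') (mkFam Y')
      (@mkFamHom C (mkFam X') (mkFam Y') k0 k).
Proof.
  intros Hf Hg EX EY E0 E.
  assert (e : A' = A) by exact (f_equal (@cod SetCat) Hf). subst A'.
  assert (e : B' = B) by exact (f_equal (@cod SetCat) Hg). subst B'.
  apply arrow_inj in Hf; apply arrow_inj in Hg; subst f g; cbn in *.
  assert (e : X = X') by now apply functional_extensionality. subst X'.
  assert (e : Y = Y') by now apply functional_extensionality. subst Y'.
  f_equal. now apply fam_hom_ext.
Qed.

Lemma cast_id (A : Type) (e : A = A) (a : A) : cast e a = a.
Proof. now rewrite (proof_irrelevance _ e eq_refl). Qed.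

Lemma fmap_eq_hom (C D : Category) (F : Functor C D) (a b : C) (e : a = b) :
  arrow (fmap F (eq_hom e)) = arrow (idm (F a)).
Proof. destruct e; cbn; now rewrite fmap_id. Qed.

Lemma arrow_idm (C : Category) (a b : C) :
  a = b -> arrow (idm a) = arrow (idm b).
Proof. now intros ->. Qed.

Section TildeMor.
Variables (S : StratInst) (HS : strict_stratification S) (B : Institution)
  (b : Base S B) (C : SubMod (tilde B)) (HC : ImageIn b C).

Definition tilde_betaC (s : SSign S) :
  Functor (SMod S s) (SMod (restrict C) (im_sign b s)) :=
  subcat_lift (@img_ob _ _ _ _ HC s) (@img_hom _ _ _ _ HC s).

Lemma tilde_betaC_nat (s o : SSign S) (f : Hom s o) :
  compF (tilde_betaC o) (red (SMod (restrict C)) (fmap (im_sign b) f))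
  = compF (red (SMod S) f) (tilde_betaC s).
Proof.
  assert (EB : forall (M : SMod S o) (w : strat S o M),
    red (Mod B) (fmap (im_sign b) f) (im_mod b o (mkSharp M w))
    = im_mod b s (mkSharp (red (SMod S) f M) (strat_red S f M w))).
  { intros M w. exact (eq_fob (im_mod_nat b f) (mkSharp M w)). }
  apply functor_ext.
  - intro M. apply sig_ext; cbn.
    refine (eq_trans _ (mkFam_strict
      (fun w => im_mod b s (mkSharp (red (SMod S) f M) w)) (HS f M))).
    exact (f_equal (@mkFam _ _) (functional_extensionality _ _ (EB M))).
  - intros M N h. apply subcat_arrow; cbn.
    apply (fam_arrow_strict (f := strat_red S f M) (g := strat_red S f N));
      try apply HS; try apply EB.
    + intro w. apply strat_red_nat.
    + intro w.
      refine (eq_trans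
        (f_equal (fun F => arrow (fmap F (pt_hom h w)))
           (im_mod_nat b f)) _); cbn.
      apply fmap_arrow, eq_sym.
      exact (pt_hom_arrow (fmap (sharp_red f) (pt_hom h w))).
Qed.

(** The lax components of [tilde_beta] are in general the pairs
    [([[M]]_f, identities)]; they are identities, as they have to be for
    [(Phi, alpha, tilde_beta)] to be strict, exactly when the functions
    [[M]]_f are. *)
Definition tilde_mor : StratMor S (restrict C).
Proof.
  unshelve refine {|
    sm_sign := im_sign b : Functor (SSign S) (SSign (restrict C));
    sm_sen := im_sen b : forall s : SSign S,
      SSen (restrict C) (im_sign b s) -> SSen S s;
    sm_mod := tilde_betaC;
    sm_lax := fun s o f M => eq_hom (eq_fob (tilde_betaC_nat f) M) |}.
  - intro s. now apply functor_ext.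
  - intros; exact (im_sen_nat b f r).
  - intros s o f M N h. apply arrow_inj.
    rewrite arrow_eq_hom_l, arrow_eq_hom_r.
    exact (f_equal (fun F => arrow (fmap F h)) (eq_sym (tilde_betaC_nat f))).
  - intros s M. rewrite arrow_eq_hom. apply arrow_idm. now rewrite red_id.
  - intros s s' s'' f g M.
    rewrite arrow_eq_hom, arrow_eq_hom_r.
    refine (eq_trans _ (eq_sym
      (fmap_eq_hom (red (SMod (restrict C)) (fmap (im_sign b) f))
         (eq_fob (tilde_betaC_nat g) M)))).
    apply arrow_idm.
    exact (eq_trans
      (f_equal (tilde_betaC s) (eq_fob (red_comp (SMod S) f g) M))
      (eq_trans
        (eq_sym (eq_fob (tilde_betaC_nat f) (red (SMod S) g M)))
        (f_equal (red (SMod (restrict C)) (fmap (im_sign b) f))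
           (eq_sym (eq_fob (tilde_betaC_nat g) M))))).
  - intros s o f M. refine (eq_trans _ (eq_sym (HS f M))).
    refine (eq_trans _
      (fmap_eq_hom (strat (restrict C) (im_sign b s))
         (eq_fob (tilde_betaC_nat f) M))).
    reflexivity.
  - intros s M w r. rewrite cast_id. exact (im_sat b (mkSharp M w) r).
Defined.

Lemma tilde_mor_strict : is_strict tilde_mor.
Proof. intros s o f M. apply arrow_eq_hom. Qed.

End TildeMor.

Record Decomposition (S S0 : StratInst) (HS : strict_stratification S)
  (B : Institution) := {
  dec_base : Base S B;
  dec_C : SubMod (tilde B);
  dec_img : ImageIn dec_base dec_C;
  dec_mor0 : StratMor S S0;
  dec_mor1 : StratMor S (restrict dec_C) := tilde_mor HS dec_img;
  dec_pullback : forall s : SSign S,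
    is_pullback (sm_mod dec_mor0 s) (sm_mod dec_mor1 s)
      (strat S0 (sm_sign dec_mor0 s))
      (strat (restrict dec_C) (sm_sign dec_mor1 s)) }.

Definition models (I : Institution) (s : Sign I) (N : Mod I s)
  (E : Sen I s -> Prop) : Prop := forall r, E r -> sat N r.

(** Only the isomorphism [i] and the triangle over [Mod(s)] are required:
    [iota] need not be functorial and [i] need not be natural. *)
Record Diagram (I : Institution) (s : Sign I) (M : Mod I s) := {
  dg_ext : Ext s;
  dg_sen : Sen I (ext_cod dg_ext) -> Prop;
  dg_iso : CatIso
    (FullSub (fun N : Mod I (ext_cod dg_ext) => models N dg_sen)) (coslice M);
  dg_tri : compF dg_iso (coslice_forget M)
           = compF (full_incl _) (red (Mod I) (ext_hom dg_ext)) }.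
Arguments dg_sen {_ _ _} _ _.

Definition DiagramSystem (I : Institution) : Type :=
  forall (s : Sign I) (M : Mod I s), Diagram M.

Definition has_diagrams (I : Institution) : Prop :=
  forall (s : Sign I) (M : Mod I s), inhabited (Diagram M).

Definition transport (C : Category) (a : C) (P : C -> Type) (x y : Ext a)
  (e : x = y) : P (ext_cod x) -> P (ext_cod y) :=
  match e in _ = z return P (ext_cod x) -> P (ext_cod z) with
  | eq_refl => fun p => p
  end.
Arguments transport {_ _} P {_ _} _ _.

Section Coherence.
Variables (B : Institution) (DB : DiagramSystem B) (C : SubMod (tilde B)).

Definition ModC : IndexedCat (Sign B) := SMod (restrict C).

(** The signature extension of the diagram of the model [B^w]. *)
Definition fib_ext (s : Sign B) (X : ModC s) (w : idx (proj1_sig X)) : Ext s :=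
  dg_ext (@DB s (fib (proj1_sig X) w)).

(** The model [N'^(f w)] of an object [(f, (V, N'))] of [W / [[_]]], seen as a
    model of the signature of the diagram of [B^w]. *)
Definition fib_at (s : Sign B) (X : ModC s) (x : Ext s)
  (Hx : forall w, fib_ext (X := X) w = x)
  (Y : comma (D := SetCat) (idx (proj1_sig X)) (strat (restrict C) (ext_cod x)))
  (w : idx (proj1_sig X)) : Mod B (ext_cod (fib_ext w)) :=
  transport (fun s' => Ob (Mod B s')) (eq_sym (Hx w))
    (fib (proj1_sig (co_ob Y)) (co_map Y w)).

Definition coh_models (s : Sign B) (X : ModC s) (x : Ext s)
  (Hx : forall w, fib_ext (X := X) w = x) : Category :=
  FullSub (fun Y : comma (D := SetCat) (idx (proj1_sig X))
                     (strat (restrict C) (ext_cod x)) =>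
             forall w : idx (proj1_sig X),
               models (fib_at Hx Y w)
                 (dg_sen (@DB s (fib (proj1_sig X) w)))).

(** [i] sends [(f, (V, N'))] to the arrow
    [(f, (i_(B^w) (N'^(f w)))_w) : (W, B) -> Mod^C(iota) (V, N')]. *)
Definition canonical (s : Sign B) (X : ModC s) (x : Ext s)
  (Hx : forall w, fib_ext (X := X) w = x)
  (i : Functor (coh_models Hx) (coslice X)) : Prop :=
  forall Y : coh_models Hx,
  let N := co_ob (proj1_sig Y) in
  let f := co_map (proj1_sig Y) in
  let N_red := red ModC (ext_hom x) N in
  exists (g : forall w : idx (proj1_sig X),
            Hom (fib (proj1_sig X) w)
              (red (Mod B) (ext_hom x) (fib (proj1_sig N) (f w))))
         (Hg : sub_hom (C s)
            (@mkFamHom _ (proj1_sig X) (proj1_sig N_red) f g)),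
    i Y = mkComma (X := X) (F := IdF (ModC s)) N_red (exist _ _ Hg) /\
    forall w : idx (proj1_sig X),
      dg_iso (@DB s (fib (proj1_sig X) w)) 
        (full_ob (fib_at Hx (proj1_sig Y) w) (proj2_sig Y w))
      = mkComma (F := IdF (Mod B s)) _ (g w).

(** When [W] is empty, the models [B^w] do not determine [iota_(s,B)], which is
    then any signature morphism satisfying the second condition. *)
Record CohDiagram (s : Sign B) (X : ModC s) := {
  cd_ext : Ext s;
  cd_eq : forall w, fib_ext (X := X) w = cd_ext;
  cd_iso : CatIso (coh_models cd_eq) (coslice X);
  cd_tri : compF cd_iso (coslice_forget X)
           = compF (compF (full_incl _) (comma_proj _ _))
               (red ModC (ext_hom cd_ext));
  cd_canonical : canonical cd_iso }.

Definition Coherent : Type := forall (s : Sign B) (X : ModC s), CohDiagram X.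

End Coherence.

Record SetcModel (A : Type) := mkSetc { car : Type; const : A -> car }.
Arguments const {_} _ _.

Definition SetcCat (A : Type) : Category.
Proof.
  unshelve refine {| Ob := SetcModel A;
    Hom := fun X Y => {f : car X -> car Y | forall c, f (const X c) = const Y c};
    idm := fun X => exist _ (fun x => x) _;
    comp := fun _ _ _ f g => exist _ (fun x => proj1_sig g (proj1_sig f x)) _ |}.
  - reflexivity.
  - intro c; cbn. now rewrite (proj2_sig f), (proj2_sig g).
  - intros; now apply sig_ext.
  - intros; now apply sig_ext.
  - intros; now apply sig_ext.
Defined.

Definition setc_under (A : Type) : Functor (SetcCat A) SetCat.
Proof.
  refine (@Build_Functor (SetcCat A) SetCat (@car A)
            (fun _ _ f => proj1_sig f) _ _); reflexivity.
Defined.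

Definition setc_red (A A' : Type) (p : A -> A') :
  Functor (SetcCat A') (SetcCat A).
Proof.
  unshelve refine (@Build_Functor (SetcCat A') (SetcCat A)
    (fun X => mkSetc (fun c => const X (p c)))
    (fun X Y f => exist _ (proj1_sig f) _) _ _).
  - intro c; apply (proj2_sig f).
  - intros; now apply sig_ext.
  - intros; now apply sig_ext.
Defined.

Definition SetcMod : IndexedCat SetCat.
Proof.
  refine {| mod_ob := SetcCat : SetCat -> Category; red := setc_red |}.
  - intro A.
    assert (Ho : forall X, setc_red (fun x : A => x) X = X) by now intros [].
    apply functor_ext; [exact Ho|].
    intros [X x] [Y y] [f Hf]; cbn. do 2 f_equal.
  - intros A A' A'' p q. apply functor_ext; [reflexivity|].
    intros X Y f. apply f_equal. now apply sig_ext.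
Defined.

(** The coherence of the lax components [nm_lax] with identities, composition
    and homomorphisms follows from that of [[_]], as [setc_under] is
    faithful. *)
Record NominalsExtraction (S : StratInst) := {
  nom : Functor (SSign S) SetCat;
  nm : forall s : SSign S, Functor (SMod S s) (SetcMod (nom s));
  nm_under : forall s : SSign S, compF (nm s) (setc_under (nom s)) = strat S s;
  nm_lax : forall (s s' : SSign S) (f : Hom s s') (M' : SMod S s'),
    Hom (red SetcMod (fmap nom f) (nm s' M')) (nm s (red (SMod S) f M'));
  nm_lax_under : forall (s s' : SSign S) (f : Hom s s') (M' : SMod S s'),
    arrow (fmap (setc_under (nom s)) (nm_lax f M'))
    = @arrow SetCat _ _ (strat_red S f M') }.

Definition nm_at (S : StratInst) (Nm : NominalsExtraction S) (s : SSign S)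
  (M : SMod S s) (i : nom Nm s) : strat S s M :=
  cast (eq_fob (nm_under Nm s) M) (const (nm Nm s M) i).
Arguments nm_at {_} _ {_} _ _.

Definition explicit_local_satisfaction (S : StratInst)
  (Nm : NominalsExtraction S) : Prop :=
  forall (s : SSign S) (r : SSen S s) (i : nom Nm s),
  exists at_i_r : SSen S s, forall (M : SMod S s) (w : strat S s M),
    ssat S M w at_i_r <-> ssat S M (nm_at Nm M i) r.

Definition has_i_sentences (S : StratInst) (Nm : NominalsExtraction S) : Prop :=
  forall (s : SSign S) (i : nom Nm s),
  exists i_sen : SSen S s, forall (M : SMod S s) (w : strat S s M),
    ssat S M w i_sen <-> nm_at Nm M i = w.

Lemma cast_cast (A A' : Type) (e : A = A') (a : A) :
  cast (eq_sym e) (cast e a) = a.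
Proof. now destruct e. Qed.

Lemma models_transport (I : Institution) (s : Sign I) (x y : Ext s) (e : x = y)
  (N : Mod I (ext_cod x)) (E : Sen I (ext_cod y) -> Prop) :
  (forall r, E r ->
     sat N (transport (fun s' => Sen I s' : Type) (eq_sym e) r)) ->
  models (transport (fun s' => Ob (Mod I s')) e N) E.
Proof. now destruct e. Qed.

Section Denote.
Variables (S S0 : StratInst) (HS : strict_stratification S) (B : Institution)
  (D : Decomposition S0 HS B)
  (Hs0 : surjective_stratification S0)
  (D0 : DiagramSystem (star Hs0)) (DB : DiagramSystem B)
  (Hcoh : Coherent DB (dec_C D))
  (Nm : NominalsExtraction S).

Definition Phi0 : Functor (SSign S) (SSign S0) := sm_sign (dec_mor0 D).
Definition Phi1 : Functor (SSign S) (Sign B) := sm_sign (dec_mor1 D).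

Definition model0 (s : SSign S) (M : SMod S s) : Mod (star Hs0) (Phi0 s) :=
  sm_mod (dec_mor0 D) s M.
Definition model1 (s : SSign S) (M : SMod S s) : ModC (dec_C D) (Phi1 s) :=
  sm_mod (dec_mor1 D) s M.

Definition diag0 (s : SSign S) (M : SMod S s) : Diagram (model0 M) :=
  @D0 (Phi0 s) (model0 M).
Definition diag1 (s : SSign S) (M : SMod S s) : CohDiagram DB (model1 M) :=
  @Hcoh (Phi1 s) (model1 M).

(** [alpha0 r] for a sentence [r] in the signature of the diagram of [M_0];
    the signature of [x] lies over it when [e] holds. *)
Definition alpha0 (s : SSign S) (M : SMod S s) (x : Ext s)
  (e : map_ext Phi0 x = dg_ext (diag0 M))
  (r : Sen (star Hs0) (ext_cod (dg_ext (diag0 M)))) : SSen S (ext_cod x) :=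
  sm_sen (dec_mor0 D) (ext_cod x)
    (transport (fun s' => SSen S0 s' : Type) (eq_sym e) r).

(** [K |= alpha0 E_(M_0)], at all states of [K]. *)
Definition satisfies_E0 (s : SSign S) (M : SMod S s) (x : Ext s)
  (e : map_ext Phi0 x = dg_ext (diag0 M)) (K : SMod S (ext_cod x)) : Prop :=
  forall r, dg_sen (diag0 M) r ->
  forall w : strat S (ext_cod x) K, ssat S K w (alpha0 e r).

Definition K0 (s : SSign S) (M : SMod S s) (x : Ext s)
  (e : map_ext Phi0 x = dg_ext (diag0 M)) (K : SMod S (ext_cod x)) :
  Mod (star Hs0) (ext_cod (dg_ext (diag0 M))) :=
  transport (fun s' => Ob (SMod S0 s')) e (model0 K).

Lemma K0_models (s : SSign S) (M : SMod S s) (x : Ext s)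
  (e : map_ext Phi0 x = dg_ext (diag0 M)) (K : SMod S (ext_cod x)) :
  satisfies_E0 e K -> models (K0 e K) (dg_sen (diag0 M)).
Proof.
  intro H. apply (@models_transport (star Hs0)). intros r Hr v.
  pose proof (proj1 (sm_sat (dec_mor0 D) K
    (cast (eq_fob (sm_strat (dec_mor0 D) (ext_cod x)) K) v) _) (H r Hr _)) as G.
  now rewrite cast_cast in G.
Qed.

Definition i0 (s : SSign S) (M : SMod S s) (x : Ext s)
  (e : map_ext Phi0 x = dg_ext (diag0 M)) (K : SMod S (ext_cod x))
  (HK : satisfies_E0 e K) : coslice (model0 M) :=
  dg_iso (diag0 M) (full_ob (K0 e K) (K0_models HK)).

(** The two sides of [den_eq] are elements of [[K]] and of
    [[Mod0(iota) K_0]]; when [S0] is strict, both sets are [[K_0]].  As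
    [den_ext] acts on objects only, no naturality of [den_n] can be asked. *)
Record Denotes := {
  den_product : is_product Phi0 Phi1;
  den_ext : forall (s : SSign S) (M : SMod S s), Ext s;
  den_ext0 : forall (s : SSign S) (M : SMod S s),
    map_ext Phi0 (den_ext M) = dg_ext (diag0 M);
  den_ext1 : forall (s : SSign S) (M : SMod S s),
    map_ext Phi1 (den_ext M) = cd_ext (diag1 M);
  den_n : forall (s : SSign S) (M : SMod S s),
    strat S s M -> nom Nm (ext_cod (den_ext M));
  den_eq : forall (s : SSign S) (M : SMod S s)
    (K : SMod S (ext_cod (den_ext M))) (HK : satisfies_E0 (den_ext0 M) K)
    (a : strat S s M),
    JMeq (nm_at Nm K (den_n a))
      (fmap (strat S0 (Phi0 s)) (co_map (i0 HK))
         (cast (eq_sym (eq_fob (sm_strat (dec_mor0 D) s) M)) a)) }.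

(** The global satisfaction of each sentence of [alpha0 E_(M_0)] is expressed
    by a sentence, as [@_i r] expresses the satisfaction of [r] at [i]; it holds
    when the satisfaction of these sentences does not depend on the state.
    Diagrams of [S0^*] are about satisfaction at all states, whereas the
    satisfaction of [S^#] only sees one state. *)
Definition explicit_global_satisfaction (den : Denotes) : Prop :=
  forall (s : SSign S) (M : SMod S s) r, dg_sen (diag0 M) r ->
  exists all_r : SSen S (ext_cod (den_ext den M)),
  forall (K : SMod S (ext_cod (den_ext den M)))
    (w : strat S (ext_cod (den_ext den M)) K),
    ssat S K w all_r <->
    forall v : strat S (ext_cod (den_ext den M)) K,
      ssat S K v (alpha0 (den_ext0 den M) r).

End Denote.

(* Main.v *)
From Stdlib Require Import FunctionalExtensionality ProofIrrelevance
  IndefiniteDescription JMeq.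
Require Import Defs.

(** Let [M] be a model of [S] over [s], let [x] be the given extension of [s]
    lying over the signatures of the diagrams of both parts [M_0] and [M_1] of
    [M], and let [K] be a model over the codomain of [x].  By the pullback
    property of the decomposition, [K] is a pair [(K_0, K_1)] with the same set
    of states, and a homomorphism [h : M -> N] is a pair [(h_0, h_1)] with the
    same function on states.  The diagram of [M_0] turns [h_0] into a [K_0]
    satisfying [E_(M_0)].  By coherence, [h_1] is a function
    [f : [[M]] -> [[K]]] together with a [K_1] whose fibre at each [f a]
    satisfies the sentences [E_(B^a)] of the diagram of the fibre of [M_1] at
    [a].  Agreement of [h_0] and [h_1] on states says that [f] is the state
    function of [i_0 K_0].  Since the diagrams denote the stratification, that
    function is [a |-> Nm(K)_(n a)], which can be read off [K] itself.  Hence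
    the homomorphisms out of [M] are the models [K] such that
     - [K] satisfies [alpha0 E_(M_0)] at all states, and
     - for each state [a] of [M], [K] satisfies [alpha1 E_(B^a)] at the state
       named by [n a].
    The second condition is expressed by the sentences [@_(n a) (alpha1 r)].
    In [S^*] the first one is expressed by [alpha0 E_(M_0)] as it stands, which
    gives (i).

    For (ii), a homomorphism out of the pointed model [(M, w)] is a
    homomorphism out of [M], the target being pointed by the image of [w]; on
    the side of the diagrams that point is the state of [K] named by [n w].  So
    the sentence [n w]-sen cuts out the right pointed models, and the first
    condition, which speaks about all states, is expressed by the sentences
    that explicit global satisfaction provides.

    The categorical content is [glued_diagram]: isomorphisms
    [i_0] and [i_1] as above glue to an isomorphism onto the coslice of [M].  It
    mentions no sentences.  [decomposed_diagram] and [model_diagram] apply it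
    to a decomposition, [pointed_diagram] passes to pointed models, and
    [star_models] and [sharp_models] axiomatise the two conditions.

    Many of the equalities involved hold between arrows whose endpoints are
    only provably equal.  Therefore functors are handled through their action
    on [Arrow], where an equation also identifies the endpoints, and a pullback
    in CAT is used through its consequence that arrows of the vertex are
    compatible pairs of arrows. *)

(** * Functors as maps on arrows *)

Definition arrow_map {C D : Category} (F : Functor C D) (u : Arrow C) :
  Arrow D := arrow (fmap F (hom_of u)).

Lemma arrow_comp {C : Category} {a b c a' b' c' : C} (f : Hom a b)
  (g : Hom b c) (f' : Hom a' b') (g' : Hom b' c') :
  arrow f = arrow f' -> arrow g = arrow g' -> arrow (f ;; g) = arrow (f' ;; g').
Proof.
  intros Hf Hg.
  assert (Ea : a = a') by exact (f_equal (@dom C) Hf).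
  assert (Eb : b = b') by exact (f_equal (@cod C) Hf).
  assert (Ec : c = c') by exact (f_equal (@cod C) Hg).
  subst a' b' c'. apply arrow_inj in Hf, Hg. now subst f' g'.
Qed.

Lemma arrow_idm_inv {C : Category} {a b : C} :
  arrow (idm a) = arrow (idm b) -> a = b.
Proof. intro H. exact (f_equal (@dom C) H). Qed.

Lemma eq_fmap {C D : Category} {F G : Functor C D} (e : F = G) {x y : C}
  (f : Hom x y) : arrow (fmap F f) = arrow (fmap G f).
Proof. now destruct e. Qed.

Lemma hom_of_arrow {C : Category} (u : Arrow C) (x y : C) :
  dom u = x -> cod u = y -> exists w : Hom x y, arrow w = u.
Proof. intros <- <-. exists (hom_of u). now destruct u. Qed.

Lemma arrow_map_inj_ob {C D : Category} (F : Functor C D) :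
  (forall u u', arrow_map F u = arrow_map F u' -> u = u') ->
  forall x y, F x = F y -> x = y.
Proof.
  intros inj x y e. apply arrow_idm_inv, inj. unfold arrow_map; cbn.
  rewrite !fmap_id. now apply arrow_idm.
Qed.

(** Since an arrow carries its endpoints, bijectivity on arrows is bijectivity
    on objects together with full faithfulness; the inverse is obtained by
    choosing preimages. *)
Lemma catiso_of_arrows {C D : Category} (F : Functor C D) :
  (forall u u', arrow_map F u = arrow_map F u' -> u = u') ->
  (forall v, exists u, arrow_map F u = v) ->
  exists i : CatIso C D, iso_fun i = F.
Proof.
  intros inj surj.
  pose proof (arrow_map_inj_ob F inj) as inj_ob.
  assert (Hob : forall y, exists x, F x = y).
  { intro y. destruct (surj (arrow (idm y))) as [u Hu]. exists (dom u).
    exact (f_equal (@dom D) Hu). }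
  pose (g := fun y => proj1_sig (constructive_indefinite_description _ (Hob y))).
  assert (Hg : forall y, F (g y) = y).
  { intro y. exact (proj2_sig (constructive_indefinite_description _ (Hob y))). }
  clearbody g.
  assert (Hhom : forall y y' (v : Hom y y'),
    exists w : Hom (g y) (g y'), arrow (fmap F w) = arrow v).
  { intros y y' v. destruct (surj (arrow v)) as [u Hu].
    destruct (hom_of_arrow u (g y) (g y')) as [w <-].
    - apply inj_ob. rewrite Hg. exact (f_equal (@dom D) Hu).
    - apply inj_ob. rewrite Hg. exact (f_equal (@cod D) Hu).
    - now exists w. }
  pose (gm := fun y y' v => proj1_sig
    (constructive_indefinite_description _ (Hhom y y' v))).
  assert (Hgm : forall y y' v, arrow (fmap F (gm y y' v)) = arrow v).
  { intros y y' v. exact (proj2_sig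
      (constructive_indefinite_description _ (Hhom y y' v))). }
  clearbody gm.
  unshelve epose (G := @Build_Functor D C g gm _ _).
  - intro y. apply arrow_inj, inj. unfold arrow_map; cbn.
    rewrite Hgm, fmap_id. now apply arrow_idm.
  - intros a b c u v. apply arrow_inj, inj. unfold arrow_map; cbn.
    rewrite Hgm, fmap_comp. now apply arrow_comp.
  - unshelve eexists.
    + refine {| iso_fun := F; iso_inv := G |}.
      * apply functor_ext.
        -- intro x. apply inj_ob, Hg.
        -- intros x y f. apply inj, Hgm.
      * apply functor_ext; [exact Hg|exact Hgm].
    + reflexivity.
Qed.

Lemma catiso_arrow_inj {C D : Category} (i : CatIso C D) (u u' : Arrow C) :
  arrow_map i u = arrow_map i u' -> u = u'.
Proof.
  intro H. apply (f_equal (arrow_map (iso_inv i))) in H.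
  pose proof (eq_fmap (iso_fun_inv i) (hom_of u)) as E.
  pose proof (eq_fmap (iso_fun_inv i) (hom_of u')) as E'.
  destruct u, u'. exact (eq_trans (eq_sym E) (eq_trans H E')).
Qed.

Lemma catiso_arrow_surj {C D : Category} (i : CatIso C D) (v : Arrow D) :
  exists u, arrow_map i u = v.
Proof.
  exists (arrow_map (iso_inv i) v). destruct v as [a b v].
  exact (eq_fmap (iso_inv_fun i) v).
Qed.

Definition catiso_comp {C D E : Category} (i : CatIso C D) (j : CatIso D E) :
  CatIso C E.
Proof.
  refine {| iso_fun := compF i j; iso_inv := compF (iso_inv j) (iso_inv i) |}.
  - apply functor_ext.
    + intro x. exact (eq_trans
        (f_equal (iso_inv i) (eq_fob (iso_fun_inv j) (i x)))
        (eq_fob (iso_fun_inv i) x)).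
    + intros x y f. exact (eq_trans
        (fmap_arrow (iso_inv i) (eq_fmap (iso_fun_inv j) (fmap i f)))
        (eq_fmap (iso_fun_inv i) f)).
  - apply functor_ext.
    + intro x. exact (eq_trans
        (f_equal j (eq_fob (iso_inv_fun i) (iso_inv j x)))
        (eq_fob (iso_inv_fun j) x)).
    + intros x y f. exact (eq_trans
        (fmap_arrow j (eq_fmap (iso_inv_fun i) (fmap (iso_inv j) f)))
        (eq_fmap (iso_inv_fun j) f)).
Defined.

(** * Pullbacks of categories on arrows *)

(** The walking arrow: functors out of it are arrows, so the universal property
    of a pullback, tested on it, speaks about single arrows. *)
Definition Two : Category.
Proof.
  unshelve refine {| Ob := bool;
    Hom := fun a b => match a, b with true, false => Empty_set | _, _ => unit end |}.
  - intros []; exact tt.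
  - intros [] [] []; cbn; try (intros; exact tt); intros f g;
      solve [destruct f | destruct g].
  - intros [] [] f; destruct f; reflexivity.
  - intros [] [] f; destruct f; reflexivity.
  - intros [] [] [] [] f g h; destruct f, g, h; reflexivity.
Defined.

Definition step : @Hom Two false true := tt.

Definition two_functor {C : Category} (u : Arrow C) : Functor Two C.
Proof.
  unshelve refine (@Build_Functor Two C
    (fun x : bool => if x then cod u else dom u) _ _ _).
  - intros [] [] f; cbn in *.
    + exact (idm _).
    + destruct f.
    + exact (hom_of u).
    + exact (idm _).
  - intros []; reflexivity.
  - intros [] [] [] f g; cbn in *; try destruct f; try destruct g; cbn;
      now rewrite ?comp_id_l, ?comp_id_r.
Defined.

Lemma two_functor_comp {C D : Category} (F : Functor C D) (u : Arrow C) :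
  compF (two_functor u) F = two_functor (arrow_map F u).
Proof.
  apply functor_ext.
  - intros []; reflexivity.
  - intros [] [] f; destruct f; cbn; now rewrite ?fmap_id.
Qed.

Definition two_arrow {C : Category} (F : Functor Two C) : Arrow C :=
  arrow (fmap F step).

Lemma two_arrow_functor {C : Category} (u : Arrow C) :
  two_arrow (two_functor u) = u.
Proof. now destruct u. Qed.

Section Pullback.
Context {P A B D : Category} {p : Functor P A} {q : Functor P B}
  {f : Functor A D} {g : Functor B D} (PB : is_pullback p q f g).

Lemma pullback_square {x y : P} (w : Hom x y) :
  arrow (fmap f (fmap p w)) = arrow (fmap g (fmap q w)).
Proof. exact (eq_fmap (proj1 PB) w). Qed.

Lemma pullback_arrow_exists (u : Arrow A) (v : Arrow B) :
  arrow_map f u = arrow_map g v ->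
  exists w, arrow_map p w = u /\ arrow_map q w = v.
Proof.
  intro e.
  destruct (proj2 PB Two (two_functor u) (two_functor v)) as [F [[Hp Hq] _]].
  - now rewrite !two_functor_comp, e.
  - exists (two_arrow F). split.
    + rewrite <- (two_arrow_functor u), <- Hp. reflexivity.
    + rewrite <- (two_arrow_functor v), <- Hq. reflexivity.
Qed.

Lemma pullback_arrow_unique (w w' : Arrow P) :
  arrow_map p w = arrow_map p w' -> arrow_map q w = arrow_map q w' -> w = w'.
Proof.
  intros Hp Hq.
  destruct (proj2 PB Two (compF (two_functor w) p) (compF (two_functor w) q))
    as [F [_ U]].
  - rewrite !two_functor_comp. f_equal.
    destruct w as [x y w]. exact (pullback_square w).
  - rewrite <- (two_arrow_functor w), <- (two_arrow_functor w').
    f_equal. transitivity F.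
    + symmetry; now apply U.
    + apply U. now rewrite !two_functor_comp, Hp, Hq.
Qed.

Lemma pullback_ob_unique (x y : P) : p x = p y -> q x = q y -> x = y.
Proof.
  intros Hp Hq. apply arrow_idm_inv, pullback_arrow_unique;
    unfold arrow_map; cbn; rewrite !fmap_id; now apply arrow_idm.
Qed.

(** The given arrows end at objects that are only provably the images of [x]
    and [y]; the glued arrow nevertheless has the endpoints [x] and [y], since
    objects of the vertex are determined by their two images. *)
Lemma pullback_hom_exists (x y : P) (a a' : A) (b b' : B) (u : Hom a a')
  (v : Hom b b') :
  p x = a -> p y = a' -> q x = b -> q y = b' ->
  arrow (fmap f u) = arrow (fmap g v) ->
  exists w : Hom x y, arrow (fmap p w) = arrow u /\ arrow (fmap q w) = arrow v.
Proof.
  intros Ea Ea' Eb Eb' e.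
  destruct (pullback_arrow_exists (arrow u) (arrow v) e) as [w [Hp Hq]].
  destruct (hom_of_arrow w x y) as [w' <-]; [| |now exists w'];
    apply pullback_ob_unique.
  - rewrite Ea. exact (f_equal (@dom A) Hp).
  - rewrite Eb. exact (f_equal (@dom B) Hq).
  - rewrite Ea'. exact (f_equal (@cod A) Hp).
  - rewrite Eb'. exact (f_equal (@cod B) Hq).
Qed.

End Pullback.

(** * Arrows of comma and full subcategories *)

Lemma full_arrow {C : Category} {P : C -> Prop} {X Y X' Y' : FullSub P}
  (u : Hom (proj1_sig X) (proj1_sig Y)) (u' : Hom (proj1_sig X') (proj1_sig Y')) :
  arrow u = arrow u' -> @arrow (FullSub P) X Y u = @arrow (FullSub P) X' Y' u'.
Proof.
  destruct X as [x hx], Y as [y hy], X' as [x' hx'], Y' as [y' hy']; cbn in *.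
  intro H.
  assert (Ex : x = x') by exact (f_equal (@dom C) H).
  assert (Ey : y = y') by exact (f_equal (@cod C) H).
  subst x' y'. apply arrow_inj in H. subst u'.
  now rewrite (proof_irrelevance _ hx' hx), (proof_irrelevance _ hy' hy).
Qed.

(** The codomain of an arrow of a comma category is determined by its domain
    and its underlying arrow. *)
Lemma comma_arrow {C D : Category} {X : D} {F : Functor C D}
  {a b a' b' : comma X F} (u : Hom a b) (u' : Hom a' b') :
  arrow (co_map a) = arrow (co_map a') ->
  arrow (proj1_sig u) = arrow (proj1_sig u') -> arrow u = arrow u'.
Proof.
  destruct a as [a f], b as [b g], a' as [a' f'], b' as [b' g'],
    u as [u Hu], u' as [u' Hu']; cbn in *.
  intros Hf H.
  assert (Ea : a = a') by exact (f_equal (@dom C) H).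
  assert (Eb : b = b') by exact (f_equal (@cod C) H).
  subst a' b'. apply arrow_inj in H, Hf. now subst u' f' g g'.
Qed.

Definition coslice_map {A B : Category} (F : Functor A B) (M : A) :
  Functor (coslice M) (coslice (F M)).
Proof.
  unshelve refine (@Build_Functor (coslice M) (coslice (F M))
    (fun X => mkComma (F := IdF B) (F (co_ob X)) (fmap F (co_map X)))
    (fun X Y v => exist _ (fmap F (proj1_sig v)) _) _ _).
  - cbn. rewrite <- fmap_comp. f_equal. exact (proj2_sig v).
  - intros; apply sig_ext, fmap_id.
  - intros; apply sig_ext, fmap_comp.
Defined.

(** * Gluing the diagrams of the two parts *)

(** The arrow [co_map (i X)] is natural in [X], being the structure map of an
    object of a coslice; as reducts keep the states, so is its function on
    states. The functions [n], [n'] and [k] are only given up to equality of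
    arrows, since they arise on the other side of a pullback. *)
Lemma diagram_states_natural {A A' : Category} {R : Functor A' A}
  {st : Functor A SetCat} {st' : Functor A' SetCat} (Hst : st' = compF R st)
  {M : A} {P : A' -> Prop} {i : CatIso (FullSub P) (coslice M)}
  (T : compF i (coslice_forget M) = compF (full_incl P) R)
  {X Y : FullSub P} (u : @Hom (FullSub P) X Y) {W V V' : Type}
  (n : W -> V) (n' : W -> V') (k : V -> V') :
  @arrow SetCat _ _ n = arrow (fmap st (co_map (i X))) ->
  @arrow SetCat _ _ n' = arrow (fmap st (co_map (i Y))) ->
  @arrow SetCat _ _ k
  = arrow (fmap st' (u : Hom (proj1_sig X) (proj1_sig Y))) ->
  @comp SetCat _ _ _ n k = n'.
Proof.
  intros Hn Hn' Hk.
  assert (Hu : @arrow SetCat _ _ k = arrow (fmap st (proj1_sig (fmap i u)))).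
  { rewrite Hk. etransitivity; [exact (eq_fmap Hst _)|].
    apply (fmap_arrow st). symmetry. exact (eq_fmap T u). }
  apply (@arrow_inj SetCat).
  rewrite (arrow_comp (C := SetCat) _ _ _ _ Hn Hu), Hn', <- fmap_comp.
  exact (f_equal (fun h => arrow (fmap st h)) (proj2_sig (fmap i u))).
Qed.

(** The unprimed data are the model categories over a signature, the primed
    ones those over its extension, and [R], [R0], [R1] the reducts.  The indices
    0 and 1 denote the two parts of the decomposition, with [st0] and [st1]
    their sets of states.  [P0] and [P1] stand for the satisfaction of the two
    diagrams, and [n K] for the interpretation in [K] of the names of the states
    of [M]. *)
Section Glue.
Context {A A0 A1 A' A0' A1' : Category}
  {p0 : Functor A A0} {p1 : Functor A A1}
  {st0 : Functor A0 SetCat} {st1 : Functor A1 SetCat}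
  (PB : is_pullback p0 p1 st0 st1)
  {p0' : Functor A' A0'} {p1' : Functor A' A1'}
  {st0' : Functor A0' SetCat} {st1' : Functor A1' SetCat}
  (PB' : is_pullback p0' p1' st0' st1')
  {R : Functor A' A} {R0 : Functor A0' A0} {R1 : Functor A1' A1}
  (Hred0 : compF p0' R0 = compF R p0) (Hred1 : compF p1' R1 = compF R p1)
  (Hst0 : st0' = compF R0 st0) (Hst1 : st1' = compF R1 st1)
  {M : A}
  {P0 : A0' -> Prop} {i0 : CatIso (FullSub P0) (coslice (p0 M))}
  (tri0 : compF i0 (coslice_forget (p0 M)) = compF (full_incl P0) R0)
  {P1 : comma (st1 (p1 M)) st1' -> Prop}
  {i1 : CatIso (FullSub P1) (coslice (p1 M))}
  (tri1 : compF i1 (coslice_forget (p1 M))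
        = compF (compF (full_incl P1) (comma_proj _ _)) R1)
  (can1 : forall Y : FullSub P1,
    arrow (fmap st1 (co_map (i1 Y)))
    = @arrow SetCat _ _ (co_map (proj1_sig Y)))
  {n : forall K : A', st1 (p1 M) -> st1' (p1' K)}
  (Hn : forall (K : A') (HK : P0 (p0' K)),
    @arrow SetCat _ _ (n K)
    = arrow (fmap st0 (co_map (i0 (full_ob (p0' K) HK)))))
  {P : A' -> Prop}
  (HP : forall K : A', P K <->
    P0 (p0' K) /\ P1 (mkComma (F := st1') (p1' K) (n K))).

Lemma n_natural (K K' : A') (HK : P0 (p0' K)) (HK' : P0 (p0' K'))
  (u : Hom K K') :
  @comp SetCat _ _ _ (n K) (fmap st1' (fmap p1' u)) = n K'.
Proof.
  apply (diagram_states_natural Hst0 tri0 (X := full_ob (p0' K) HK)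
           (Y := full_ob (p0' K') HK') (fmap p0' u)); try apply Hn.
  symmetry. apply (pullback_square PB').
Qed.

Definition part0 : Functor (FullSub P) (FullSub P0).
Proof.
  refine (@Build_Functor (FullSub P) (FullSub P0)
    (fun K => full_ob (p0' (proj1_sig K)) (proj1 (proj1 (HP _) (proj2_sig K))))
    (fun K K' u => fmap p0' (u : Hom (proj1_sig K) (proj1_sig K'))) _ _).
  - intro K. exact (fmap_id p0' (proj1_sig K)).
  - intros K K' K'' u v. exact (fmap_comp p0' _ _).
Defined.

Definition part1 : Functor (FullSub P) (FullSub P1).
Proof.
  unshelve refine (@Build_Functor (FullSub P) (FullSub P1)
    (fun K => full_ob (C := comma _ st1')
                (mkComma (F := st1') (p1' (proj1_sig K)) (n (proj1_sig K)))
                (proj2 (proj1 (HP _) (proj2_sig K))))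
    (fun K K' u => exist _ (fmap p1' (u : Hom (proj1_sig K) (proj1_sig K'))) _)
    _ _).
  - exact (n_natural _ _ (proj1 (proj1 (HP _) (proj2_sig K)))
             (proj1 (proj1 (HP _) (proj2_sig K'))) u).
  - intro K. apply sig_ext. exact (fmap_id p1' (proj1_sig K)).
  - intros K K' K'' u v. apply sig_ext. exact (fmap_comp p1' _ _).
Defined.

(** The two structure maps agree on states: on the side of 0 this is [Hn], on
    the side of 1 it is the canonicity of [i1]. *)
Lemma glued_map_exists (K : FullSub P) :
  exists h : Hom M (R (proj1_sig K)),
    arrow (fmap p0 h) = arrow (co_map (i0 (part0 K))) /\
    arrow (fmap p1 h) = arrow (co_map (i1 (part1 K))).
Proof.
  apply (pullback_hom_exists PB); try reflexivity.
  - exact (eq_trans (eq_sym (eq_fob Hred0 (proj1_sig K)))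
             (eq_sym (eq_fob tri0 (part0 K)))).
  - exact (eq_trans (eq_sym (eq_fob Hred1 (proj1_sig K)))
             (eq_sym (eq_fob tri1 (part1 K)))).
  - etransitivity; [|symmetry; exact (can1 (part1 K))].
    symmetry; apply Hn.
Qed.

Definition glued_map (K : FullSub P) : Hom M (R (proj1_sig K)) :=
  proj1_sig (constructive_indefinite_description _ (glued_map_exists K)).

Lemma glued_map0 (K : FullSub P) :
  arrow (fmap p0 (glued_map K)) = arrow (co_map (i0 (part0 K))).
Proof.
  exact (proj1 (proj2_sig
    (constructive_indefinite_description _ (glued_map_exists K)))).
Qed.

Lemma glued_map1 (K : FullSub P) :
  arrow (fmap p1 (glued_map K)) = arrow (co_map (i1 (part1 K))).
Proof.
  exact (proj2 (proj2_sig
    (constructive_indefinite_description _ (glued_map_exists K)))).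
Qed.

Lemma reduct_p0 (K K' : FullSub P) (u : Hom K K') :
  arrow (fmap p0 (fmap R u)) = arrow (proj1_sig (fmap i0 (fmap part0 u))).
Proof.
  etransitivity; [exact (eq_sym (eq_fmap Hred0 u))|].
  symmetry. exact (eq_fmap tri0 (fmap part0 u)).
Qed.

Lemma reduct_p1 (K K' : FullSub P) (u : Hom K K') :
  arrow (fmap p1 (fmap R u)) = arrow (proj1_sig (fmap i1 (fmap part1 u))).
Proof.
  etransitivity; [exact (eq_sym (eq_fmap Hred1 u))|].
  symmetry. exact (eq_fmap tri1 (fmap part1 u)).
Qed.

Lemma glued_map_natural (K K' : FullSub P) (u : Hom K K') :
  glued_map K ;; fmap R u = glued_map K'.
Proof.
  apply arrow_inj, (pullback_arrow_unique PB); unfold arrow_map; cbn;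
    rewrite fmap_comp.
  - rewrite (arrow_comp _ _ _ _ (glued_map0 K) (reduct_p0 _ _ u)), glued_map0.
    f_equal. exact (proj2_sig (fmap i0 (fmap part0 u))).
  - rewrite (arrow_comp _ _ _ _ (glued_map1 K) (reduct_p1 _ _ u)), glued_map1.
    f_equal. exact (proj2_sig (fmap i1 (fmap part1 u))).
Qed.

Definition glued : Functor (FullSub P) (coslice M).
Proof.
  refine (@Build_Functor (FullSub P) (coslice M)
    (fun K => mkComma (F := IdF A) (R (proj1_sig K)) (glued_map K))
    (fun K K' u => exist _ (fmap R (u : Hom (proj1_sig K) (proj1_sig K')))
                     (glued_map_natural K K' u)) _ _).
  - intro K. apply sig_ext. exact (fmap_id R (proj1_sig K)).
  - intros K K' K'' u v. apply sig_ext. exact (fmap_comp R _ _).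
Defined.

Lemma glued_0 (u : Arrow (FullSub P)) :
  arrow_map (coslice_map p0 M) (arrow_map glued u)
  = arrow_map i0 (arrow_map part0 u).
Proof.
  destruct u as [K K' u]. apply comma_arrow; [apply glued_map0|].
  apply reduct_p0.
Qed.

Lemma glued_1 (u : Arrow (FullSub P)) :
  arrow_map (coslice_map p1 M) (arrow_map glued u)
  = arrow_map i1 (arrow_map part1 u).
Proof.
  destruct u as [K K' u]. apply comma_arrow; [apply glued_map1|].
  apply reduct_p1.
Qed.

(** The coslice of [M] inherits from the pullback that its arrows are determined
    by their two images; with [glued_0] and [glued_1] this reduces the
    bijectivity of [glued] to that of [i0] and [i1]. *)
Lemma coslice_arrow_unique (v v' : Arrow (coslice M)) :
  arrow_map (coslice_map p0 M) v = arrow_map (coslice_map p0 M) v' ->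
  arrow_map (coslice_map p1 M) v = arrow_map (coslice_map p1 M) v' -> v = v'.
Proof.
  destruct v as [X Y v], v' as [X' Y' v']. intros H0 H1.
  apply comma_arrow; apply (pullback_arrow_unique PB).
  - exact (f_equal
      (fun w : Arrow (coslice (p0 M)) => arrow (co_map (dom w))) H0).
  - exact (f_equal
      (fun w : Arrow (coslice (p1 M)) => arrow (co_map (dom w))) H1).
  - exact (f_equal
      (fun w : Arrow (coslice (p0 M)) => arrow (proj1_sig (hom_of w))) H0).
  - exact (f_equal
      (fun w : Arrow (coslice (p1 M)) => arrow (proj1_sig (hom_of w))) H1).
Qed.

Lemma glued_inj (u u' : Arrow (FullSub P)) :
  arrow_map glued u = arrow_map glued u' -> u = u'.
Proof.
  intro H.
  assert (H0 : arrow_map part0 u = arrow_map part0 u').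
  { apply (catiso_arrow_inj i0). now rewrite <- !glued_0, H. }
  assert (H1 : arrow_map part1 u = arrow_map part1 u').
  { apply (catiso_arrow_inj i1). now rewrite <- !glued_1, H. }
  destruct u as [K L u], u' as [K' L' u']. apply full_arrow.
  apply (pullback_arrow_unique PB').
  - exact (f_equal (arrow_map (full_incl P0)) H0).
  - exact (f_equal (arrow_map (compF (full_incl P1) (comma_proj _ _))) H1).
Qed.

(** An object of [M / A] has a preimage on each side.  The side of 1 produces a
    model together with its own function on states; compatibility with the side
    of 0 forces that function to be [n K], which is why nothing but [K] has to
    be remembered. *)
Lemma glued_ob_surj (X : coslice M) (X0 : FullSub P0) (Y : FullSub P1)
  (K : A') :
  i0 X0 = coslice_map p0 M X -> i1 Y = coslice_map p1 M X ->
  p0' K = proj1_sig X0 -> p1' K = co_ob (proj1_sig Y) ->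
  mkComma (F := st1') (p1' K) (n K) = proj1_sig Y /\ P K.
Proof.
  intros H0 H1 e0 e1.
  destruct X0 as [X0 HX0]; cbn in e0. subst X0.
  assert (En : @arrow SetCat _ _ (n K)
               = @arrow SetCat _ _ (co_map (proj1_sig Y))).
  { etransitivity; [apply (Hn K HX0)|].
    etransitivity; [|apply can1].
    etransitivity;
      [exact (f_equal
         (fun Z : coslice (p0 M) => arrow (fmap st0 (co_map Z))) H0)|].
    etransitivity;
      [|exact (eq_sym (f_equal
         (fun Z : coslice (p1 M) => arrow (fmap st1 (co_map Z))) H1))].
    apply (pullback_square PB). }
  assert (EY : mkComma (F := st1') (p1' K) (n K) = proj1_sig Y).
  { clear H1. destruct Y as [[Y f] HY]; cbn in *. subst Y.
    now apply arrow_inj in En; subst f. }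
  split; [exact EY|]. apply HP. split; [exact HX0|].
  rewrite EY. exact (proj2_sig Y).
Qed.

Lemma glued_surj (v : Arrow (coslice M)) : exists u, arrow_map glued u = v.
Proof.
  destruct (catiso_arrow_surj i0 (arrow_map (coslice_map p0 M) v))
    as [u0 Hu0].
  destruct (catiso_arrow_surj i1 (arrow_map (coslice_map p1 M) v))
    as [u1 Hu1].
  destruct (pullback_arrow_exists PB' (arrow_map (full_incl P0) u0)
    (arrow_map (compF (full_incl P1) (comma_proj _ _)) u1)) as [w [Hw0 Hw1]].
  (* Both sides have the states of the reduct, hence those of [v]. *)
  { destruct u0 as [X0 Y0 u0], u1 as [X1 Y1 u1], v as [X Y v].
    etransitivity; [exact (eq_fmap Hst0 _)|].
    etransitivity; [|symmetry; exact (eq_fmap Hst1 _)].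
    etransitivity; [apply (fmap_arrow st0); symmetry; exact (eq_fmap tri0 u0)|].
    etransitivity; [|apply (fmap_arrow st1); exact (eq_fmap tri1 u1)].
    etransitivity;
      [apply (fmap_arrow st0); exact (f_equal
        (fun w : Arrow (coslice (p0 M)) => arrow (proj1_sig (hom_of w))) Hu0)|].
    etransitivity;
      [|apply (fmap_arrow st1); symmetry; exact (f_equal
        (fun w : Arrow (coslice (p1 M)) => arrow (proj1_sig (hom_of w))) Hu1)].
    apply (pullback_square PB). }
  destruct w as [K L w].
  destruct (glued_ob_surj (dom v) (dom u0) (dom u1) K) as [EK HK].
  { exact (f_equal (@dom _) Hu0). }
  { exact (f_equal (@dom _) Hu1). }
  { exact (f_equal (@dom _) Hw0). }
  { exact (f_equal (@dom _) Hw1). }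
  destruct (glued_ob_surj (cod v) (cod u0) (cod u1) L) as [EL HL].
  { exact (f_equal (@cod _) Hu0). }
  { exact (f_equal (@cod _) Hu1). }
  { exact (f_equal (@cod _) Hw0). }
  { exact (f_equal (@cod _) Hw1). }
  exists (@arrow (FullSub P) (full_ob K HK) (full_ob L HL) w).
  apply coslice_arrow_unique.
  - rewrite glued_0, <- Hu0. f_equal. destruct u0 as [X0 Y0 u0].
    apply full_arrow. exact Hw0.
  - rewrite glued_1, <- Hu1. f_equal. destruct u1 as [X1 Y1 u1].
    apply full_arrow, comma_arrow.
    + exact (f_equal (fun Z : CommaOb _ st1' => @arrow SetCat _ _ (co_map Z)) EK).
    + exact Hw1.
Qed.

(** The function on states of [i K] is kept because it decides where the point
    of a pointed model goes. *)
Theorem glued_diagram :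
  exists i : CatIso (FullSub P) (coslice M),
    compF i (coslice_forget M) = compF (full_incl P) R /\
    forall K : FullSub P,
      arrow (fmap st1 (fmap p1 (co_map (i K))))
      = @arrow SetCat _ _ (n (proj1_sig K)).
Proof.
  destruct (catiso_of_arrows glued glued_inj glued_surj) as [i Hi].
  exists i. rewrite Hi. split.
  - now apply functor_ext.
  - intro K. exact (eq_trans (fmap_arrow st1 (glued_map1 K)) (can1 (part1 K))).
Qed.

End Glue.

(** * Strictness *)

Lemma arrow_idm_l {C : Category} {a b c d : C} (f : Hom a b) (g : Hom b c) :
  arrow f = arrow (idm d) -> arrow (f ;; g) = arrow g.
Proof.
  intro H.
  assert (e : d = b) by exact (eq_sym (f_equal (@cod C) H)). subst d.
  rewrite (arrow_comp _ _ _ _ H (eq_refl (arrow g))). now rewrite comp_id_l.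
Qed.

Lemma arrow_idm_r {C : Category} {a b c d : C} (f : Hom a b) (g : Hom b c) :
  arrow g = arrow (idm d) -> arrow (f ;; g) = arrow f.
Proof.
  intro H.
  assert (e : d = b) by exact (eq_sym (f_equal (@dom C) H)). subst d.
  rewrite (arrow_comp _ _ _ _ (eq_refl (arrow f)) H). now rewrite comp_id_r.
Qed.

Lemma strict_strat {S : StratInst} (HS : strict_stratification S)
  {s s' : SSign S} (f : Hom s s') :
  strat S s' = compF (red (SMod S) f) (strat S s).
Proof.
  apply functor_ext.
  - intro K. symmetry. exact (f_equal (@cod SetCat) (HS _ _ f K)).
  - intros K L u.
    rewrite <- (arrow_idm_r (C := SetCat) (fmap (strat S s') u)
                  (strat_red S f L) (HS _ _ f L)).
    etransitivity;
      [|exact (arrow_idm_l (C := SetCat) (strat_red S f K)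
          (fmap (strat S s) (fmap (red (SMod S) f) u)) (HS _ _ f K))].
    f_equal. extensionality w. apply strat_red_nat.
Qed.

Lemma strict_mod {S' S : StratInst} {m : StratMor S' S} (Hm : is_strict m)
  {s o : SSign S'} (f : Hom s o) :
  compF (sm_mod m o) (red (SMod S) (fmap (sm_sign m) f))
  = compF (red (SMod S') f) (sm_mod m s).
Proof.
  apply functor_ext.
  - intro K. exact (f_equal (@dom _) (Hm _ _ f K)).
  - intros K L u.
    etransitivity;
      [|exact (arrow_idm_l (sm_lax m f K)
          (fmap (sm_mod m s) (fmap (red (SMod S') f) u)) (Hm _ _ f K))].
    rewrite (sm_lax_nat m f u). symmetry.
    exact (arrow_idm_r _ (sm_lax m f L) (Hm _ _ f L)).
Qed.

(** * Pointed models *)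

Section Pointed.
Context {S : StratInst} (HS : strict_stratification S) {s : SSign S}
  {M : SMod S s} (w : strat S s M).

(** The target of a homomorphism out of [(M, w)] is pointed by the image of
    [w]. *)
Definition pointed_coslice :
  CatIso (coslice M) (coslice (C := SharpCat s) (mkSharp M w)).
Proof.
  unshelve refine {|
    iso_fun := @Build_Functor (coslice M) (coslice (C := SharpCat s) (mkSharp M w))
      (fun X => mkComma (F := IdF (SharpCat s))
         (mkSharp (co_ob X) (fmap (strat S s) (co_map X) w))
         (pt_hom (co_map X) w))
      (fun X Y v => exist _ (exist _ (proj1_sig v) _) _) _ _;
    iso_inv := @Build_Functor (coslice (C := SharpCat s) (mkSharp M w)) (coslice M)
      (fun X => mkComma (F := IdF (SMod S s)) (sh_mod (co_ob X))
         (proj1_sig (co_map X)))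
      (fun X Y v => exist _ (proj1_sig (proj1_sig v)) _) _ _ |}.
  - cbn. destruct v as [v Hv]; cbn in *. now rewrite <- Hv, fmap_comp.
  - apply sig_ext. exact (proj2_sig v).
  - intros; now do 2 apply sig_ext.
  - intros; now do 2 apply sig_ext.
  - exact (f_equal (@proj1_sig _ _) (proj2_sig v)).
  - intros; now apply sig_ext.
  - intros; now apply sig_ext.
  - apply functor_ext; [now intros []|].
    intros [X h] [Y k] v. now apply comma_arrow.
  - assert (Ho : forall X : coslice (C := SharpCat s) (mkSharp M w),
      mkComma (F := IdF (SharpCat s))
         (mkSharp (sh_mod (co_ob X)) (fmap (strat S s) (proj1_sig (co_map X)) w))
         (pt_hom (proj1_sig (co_map X)) w) = X).
    { intros [[N v] [h Hh]]; cbn in *. now subst v. }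
    apply functor_ext; [exact Ho|].
    intros X Y v. apply comma_arrow.
    + exact (f_equal (fun Z : coslice (C := SharpCat s) (mkSharp M w) =>
                        arrow (co_map Z)) (Ho X)).
    + apply sharp_arrow; [exact (f_equal (@co_ob _ _ _ _) (Ho X))
                         |exact (f_equal (@co_ob _ _ _ _) (Ho Y))|reflexivity].
Defined.

Context {s' : SSign S} {f : Hom s s'} {P : SMod S s' -> Prop}
  {i : CatIso (FullSub P) (coslice M)}
  (T : compF i (coslice_forget M) = compF (full_incl P) (red (SMod S) f))
  {n : forall K : SMod S s', strat S s M -> strat S s' K}
  (Hn : forall K : FullSub P,
    arrow (fmap (strat S s) (co_map (i K)))
    = @arrow SetCat _ _ (n (proj1_sig K)))
  {Q : SharpCat s' -> Prop}
  (HQ : forall X : SharpCat s', Q X <-> P (sh_mod X) /\ n (sh_mod X) w = sh_pt X).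

(** Sending [K] to [(K, n K w)] is functorial because [n] is natural. *)
Definition pointed_models : CatIso (FullSub Q) (FullSub P).
Proof.
  unshelve refine {|
    iso_fun := @Build_Functor (FullSub Q) (FullSub P)
      (fun X => full_ob (sh_mod (proj1_sig X)) (proj1 (proj1 (HQ _) (proj2_sig X))))
      (fun X Y u => proj1_sig u) _ _;
    iso_inv := @Build_Functor (FullSub P) (FullSub Q)
      (fun K => full_ob (C := SharpCat s')
         (mkSharp (proj1_sig K) (n (proj1_sig K) w))
         (proj2 (HQ (mkSharp (proj1_sig K) (n (proj1_sig K) w)))
            (conj (proj2_sig K) eq_refl)))
      (fun K L u => exist _ (u : Hom (proj1_sig K) (proj1_sig L)) _) _ _ |};
    try reflexivity.
  - exact (f_equal (fun g => g w)
      (diagram_states_natural (strict_strat HS f) T u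
         (n (proj1_sig K)) (n (proj1_sig L)) _
         (eq_sym (Hn K)) (eq_sym (Hn L)) eq_refl)).
  - intros; now apply sig_ext.
  - intros; now apply sig_ext.
  - assert (Ho : forall X : FullSub Q,
      mkSharp (sh_mod (proj1_sig X)) (n (sh_mod (proj1_sig X)) w) = proj1_sig X).
    { intros [[K v] HX]; cbn.
      pose proof (proj2 (proj1 (HQ _) HX)) as E; cbn in E. now rewrite E. }
    apply functor_ext.
    + intro X. apply sig_ext, Ho.
    + intros X Y u. apply full_arrow, sharp_arrow; [apply Ho|apply Ho|reflexivity].
  - apply functor_ext.
    + intro K. now apply sig_ext.
    + intros K L u. now apply full_arrow.
Defined.

Theorem pointed_diagram :
  exists j : CatIso (FullSub Q) (coslice (C := SharpCat s) (mkSharp M w)),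
    compF j (coslice_forget (C := SharpCat s) (mkSharp M w))
    = compF (full_incl Q) (sharp_red f).
Proof.
  exists (catiso_comp (catiso_comp pointed_models i) pointed_coslice).
  assert (Ho : forall X : FullSub Q,
    mkSharp (co_ob (i (pointed_models X)))
      (fmap (strat S s) (co_map (i (pointed_models X))) w)
    = sharp_red f (proj1_sig X)).
  { intro X. apply sharp_ob_eq.
    - exact (eq_fob T (pointed_models X)).
    - pose proof (proj2 (proj1 (HQ _) (proj2_sig X))) as E.
      eapply JMeq_trans.
      + exact (set_arrow_JMeq (Hn (pointed_models X)) (JMeq_refl w)).
      + apply JMeq_sym. eapply JMeq_trans.
        * exact (set_arrow_JMeq (HS _ _ f _) (JMeq_refl (sh_pt (proj1_sig X)))).
        * rewrite <- E. apply JMeq_refl. }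
  apply functor_ext; [exact Ho|].
  intros X Y u. apply sharp_arrow; [apply Ho|apply Ho|].
  exact (eq_fmap T (fmap pointed_models u)).
Qed.

End Pointed.

(** * Diagrams of decomposed models *)

Lemma models_transport_iff {I : Institution} {s : Sign I} {x y : Ext s}
  (e : x = y) (N : Mod I (ext_cod x)) (E : Sen I (ext_cod y) -> Prop) :
  models (transport (fun s' => Ob (Mod I s')) e N) E <->
  forall r, E r -> sat N (transport (fun s' => Sen I s' : Type) (eq_sym e) r).
Proof. now destruct e. Qed.

Lemma set_arrow_ext {X Y X' Y' : Type} (f : X -> Y) (g : X' -> Y')
  (eX : X = X') (eY : Y = Y') :
  (forall a, JMeq (f a) (g (cast eX a))) ->
  @arrow SetCat X Y f = @arrow SetCat X' Y' g.
Proof.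
  destruct eX, eY. intro H. f_equal. extensionality a. apply JMeq_eq, H.
Qed.

Section Decomposed.
Context {S S0 : StratInst} {B : Institution}
  {HS : strict_stratification S} (HS0 : strict_stratification S0)
  {Hs0 : surjective_stratification S0} {D : Decomposition S0 HS B}
  (Hbeta0 : is_strict (dec_mor0 D)) {DB : DiagramSystem B}.

Definition fiber {s : SSign S} {K : SMod S s} (w : strat S s K) :
  Mod B (Phi1 D s) :=
  fib (proj1_sig (model1 D K)) w.

(** The extensions of the diagrams of both parts are variables here, so that
    [e0] and [e1] can be eliminated: once both signatures are literally the
    images of [x], all transports disappear, except those along [cd_eq]. *)
Lemma decomposed_diagram {s : SSign S} {M : SMod S s} {x : Ext s}
  (d0 : Diagram (model0 D Hs0 M)) (e0 : map_ext (Phi0 D) x = dg_ext d0)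
  (d1 : CohDiagram DB (model1 D M)) (e1 : map_ext (Phi1 D) x = cd_ext d1)
  (n : forall K : SMod S (ext_cod x), strat S s M -> strat S (ext_cod x) K)
  (Hn : forall (K : SMod S (ext_cod x))
     (HK : models (I := star Hs0)
             (transport (fun s' => Ob (SMod S0 s')) e0 (model0 D Hs0 K))
             (dg_sen d0)) (a : strat S s M),
     JMeq (n K a)
       (fmap (strat S0 (Phi0 D s)) (co_map (dg_iso d0 (full_ob _ HK)))
         (cast (eq_sym (eq_fob (sm_strat (dec_mor0 D) s) M)) a)))
  (P : SMod S (ext_cod x) -> Prop)
  (HP : forall K : SMod S (ext_cod x), P K <->
     models (I := star Hs0)
             (transport (fun s' => Ob (SMod S0 s')) e0 (model0 D Hs0 K))
       (dg_sen d0) /\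
     forall a : strat S s M,
       models (transport (fun s' => Ob (Mod B s'))
                 (eq_trans e1 (eq_sym (cd_eq d1 a))) (fiber (n K a)))
         (dg_sen (DB _ (fiber a)))) :
  exists i : CatIso (FullSub P) (coslice M),
    compF i (coslice_forget M) = compF (full_incl P) (red (SMod S) (ext_hom x)) /\
    forall K : FullSub P,
      arrow (fmap (strat S s) (co_map (i K)))
      = @arrow SetCat _ _ (n (proj1_sig K)).
Proof.
  destruct d0 as [y0 E0 j0 t0], d1 as [y1 Ey1 j1 t1 c1]; cbn in *.
  subst y0 y1. cbn in *.
  refine (glued_diagram (dec_pullback D s) (dec_pullback D (ext_cod x))
    (strict_mod Hbeta0 (ext_hom x))
    (tilde_betaC_nat HS (dec_img D) (ext_hom x))
    (strict_strat HS0 (fmap (Phi0 D) (ext_hom x)))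
    (strict_strat (S := restrict (dec_C D)) (fun _ _ _ _ => eq_refl)
       (fmap (Phi1 D) (ext_hom x)))
    t0 t1 _ (n := n) _ _).
  - intro Y. destruct (c1 Y) as [g [Hg [E _]]].
    exact (f_equal (fun Z : coslice (model1 D M) =>
      arrow (fmap (strat (restrict (dec_C D)) (Phi1 D s)) (co_map Z))) E).
  - intros K HK.
    (* [[M]] may be empty, so that [Hn] does not imply the equality of the
       codomains, which comes from the strictness of the reducts. *)
    refine (set_arrow_ext _ _ (eq_sym (eq_fob (sm_strat (dec_mor0 D) s) M)) _
              (Hn K HK)).
    refine (eq_trans (eq_sym (eq_fob (sm_strat (dec_mor0 D) (ext_cod x)) K)) _).
    refine (eq_trans (eq_fob (strict_strat HS0 (fmap (Phi0 D) (ext_hom x))) _) _).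
    exact (f_equal (strat S0 (Phi0 D s))
             (eq_sym (eq_fob t0 (full_ob (model0 D Hs0 K) HK)))).
  - intro K. rewrite HP. apply and_iff_compat_l.
    split; intros H a; specialize (H a).
    + unfold fib_at. now rewrite (proof_irrelevance _ _
        (eq_trans eq_refl (eq_sym (Ey1 a)))).
    + unfold fib_at in H. now rewrite (proof_irrelevance _ _
        (eq_sym (Ey1 a))).
Qed.

Context {D0 : DiagramSystem (star Hs0)} {Hcoh : Coherent DB (dec_C D)}
  {Nm : NominalsExtraction S} (den : Denotes D0 Hcoh Nm).

Section Model.
Context {s : SSign S} (M : SMod S s).

Let x : Ext s := den_ext den M.

(** The interpretation in [K] of the name of a state of [M]. *)
Definition naming (K : SMod S (ext_cod x)) (a : strat S s M) :
  strat S (ext_cod x) K :=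
  nm_at Nm K (den_n den a).

Definition alpha1 (a : strat S s M)
  (r : Sen B (ext_cod (dg_ext (DB _ (fiber a))))) : SSen S (ext_cod x) :=
  sm_sen (dec_mor1 D) (ext_cod x)
    (transport (fun s' => Sen B s' : Type)
       (eq_sym (eq_trans (den_ext1 den M) (eq_sym (cd_eq (diag1 Hcoh M) a)))) r).

Definition satisfies_E1 (K : SMod S (ext_cod x)) : Prop :=
  forall (a : strat S s M) r, dg_sen (DB _ (fiber a)) r ->
  ssat S K (naming K a) (alpha1 a r).

(** Satisfaction at all states transfers between [K] and [K_0] because the two
    have the same states. *)
Lemma satisfies_E0_iff (K : SMod S (ext_cod x)) :
  satisfies_E0 (den_ext0 den M) K <->
  models (K0 (den_ext0 den M) K) (dg_sen (diag0 D D0 M)).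
Proof.
  split; [apply K0_models|]. intros H r Hr w.
  apply (sm_sat (dec_mor0 D)).
  exact (proj1 (models_transport_iff (I := star Hs0) (den_ext0 den M)
    (model0 D Hs0 K) _) H r Hr _).
Qed.

Lemma satisfies_E1_iff (K : SMod S (ext_cod x)) :
  satisfies_E1 K <->
  forall a : strat S s M,
    models (transport (fun s' => Ob (Mod B s'))
              (eq_trans (den_ext1 den M) (eq_sym (cd_eq (diag1 Hcoh M) a)))
              (fiber (naming K a)))
      (dg_sen (DB _ (fiber a))).
Proof.
  split; intros H a.
  - apply models_transport_iff. intros r Hr.
    pose proof (proj1 (sm_sat (dec_mor1 D) K _ _) (H a r Hr)) as G.
    rewrite cast_id in G. exact G.
  - intros r Hr. apply (sm_sat (dec_mor1 D)). rewrite cast_id.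
    exact (proj1 (models_transport_iff _ _ _) (H a) r Hr).
Qed.

Lemma model_diagram (P : SMod S (ext_cod x) -> Prop)
  (HP : forall K : SMod S (ext_cod x),
     P K <-> satisfies_E0 (den_ext0 den M) K /\ satisfies_E1 K) :
  exists i : CatIso (FullSub P) (coslice M),
    compF i (coslice_forget M) = compF (full_incl P) (red (SMod S) (ext_hom x)) /\
    forall K : FullSub P,
      arrow (fmap (strat S s) (co_map (i K)))
      = @arrow SetCat _ _ (naming (proj1_sig K)).
Proof.
  apply (decomposed_diagram (diag0 D D0 M) (den_ext0 den M) (diag1 Hcoh M)
    (den_ext1 den M)).
  - intros K HK a.
    eapply JMeq_trans; [exact (den_eq (proj2 (satisfies_E0_iff K) HK) a)|].
    unfold i0. now rewrite (proof_irrelevance _ _ HK).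
  - intro K. now rewrite HP, satisfies_E0_iff, satisfies_E1_iff.
Qed.

(** Such a [p] is a choice of [@_(n a) r].  Taking all of them, rather than
    choosing one for each [a] and [r], does not change the models. *)
Definition at_name (a : strat S s M) (r p : SSen S (ext_cod x)) : Prop :=
  forall (K : SMod S (ext_cod x)) (w : strat S (ext_cod x) K),
    ssat S K w p <-> ssat S K (naming K a) r.

Definition fiber_sen (p : SSen S (ext_cod x)) : Prop :=
  exists (a : strat S s M) r, dg_sen (DB _ (fiber a)) r /\ at_name a (alpha1 a r) p.

Definition star_sen (p : SSen S (ext_cod x)) : Prop :=
  (exists r, dg_sen (diag0 D D0 M) r /\ p = alpha0 (den_ext0 den M) r)
  \/ fiber_sen p.

Definition sharp_sen (b : strat S s M) (p : SSen S (ext_cod x)) : Prop :=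
  (exists r, dg_sen (diag0 D D0 M) r /\
     forall (K : SMod S (ext_cod x)) (w : strat S (ext_cod x) K),
       ssat S K w p <->
       forall v : strat S (ext_cod x) K,
         ssat S K v (alpha0 (den_ext0 den M) r))
  \/ fiber_sen p
  \/ forall (K : SMod S (ext_cod x)) (w : strat S (ext_cod x) K),
       ssat S K w p <-> naming K b = w.

Context (Hat : explicit_local_satisfaction Nm).

(** A sentence [@_(n a) r] has the same truth value at all states, so its
    satisfaction at all states implies [r] at the state named by [n a], which
    exists whenever [M] has the state [a]. *)
Lemma star_models (Hs : surjective_stratification S) (K : SMod S (ext_cod x)) :
  models (I := star Hs) K star_sen <->
  satisfies_E0 (den_ext0 den M) K /\ satisfies_E1 K.
Proof.
  split.
  - intro H. split.
    + intros r Hr. apply (H (alpha0 (den_ext0 den M) r)). left. now exists r.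
    + intros a r Hr.
      destruct (Hat _ (alpha1 a r) (den_n den a)) as [p Hp].
      apply (Hp K (naming K a)), (H p). right. now exists a, r.
  - intros [H0 H1] p [[r [Hr ->]]|[a [r [Hr Hp]]]] w.
    + now apply H0.
    + now apply Hp, H1.
Qed.

Lemma sharp_models (Hsen : has_i_sentences Nm)
  (Hall : explicit_global_satisfaction den) (b : strat S s M)
  (X : SharpCat (S := S) (ext_cod x)) :
  models (I := sharp S) X (sharp_sen b) <->
  (satisfies_E0 (den_ext0 den M) (sh_mod X) /\ satisfies_E1 (sh_mod X)) /\
  naming (sh_mod X) b = sh_pt X.
Proof.
  destruct X as [K v]; cbn. split.
  - intro H. repeat split.
    + intros r Hr. destruct (Hall s M r Hr) as [p Hp].
      apply (Hp K v), (H p). left. now exists r.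
    + intros a r Hr.
      destruct (Hat _ (alpha1 a r) (den_n den a)) as [p Hp].
      apply (Hp K v), (H p). right; left. now exists a, r.
    + destruct (Hsen _ (den_n den b)) as [p Hp].
      apply (Hp K v), (H p). now right; right.
  - intros [[H0 H1] Hv] p [[r [Hr Hp]]|[[a [r [Hr Hp]]]|Hp]]; apply Hp.
    + now apply H0.
    + now apply H1.
    + exact Hv.
Qed.

End Model.
End Decomposed.


Theorem theorem5p1
  (S S0 : StratInst) (B : Institution)
  (HS : strict_stratification S)
  (HS0 : strict_stratification S0)
  (Hs0 : surjective_stratification S0)
  (D : Decomposition S0 HS B)
  (Hbeta0 : is_strict (dec_mor0 D))
  (isoS : iso_invariant S)
  (isoS0 : iso_invariant S0)
  (isoB : iso_invariant (restrict (dec_C D)))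
  (D0 : DiagramSystem (star Hs0))
  (DB : DiagramSystem B)
  (Hcoh : Coherent DB (dec_C D))
  (Nm : NominalsExtraction S)
  (den : Denotes D0 Hcoh Nm) :
  (forall Hs : surjective_stratification S,
     explicit_local_satisfaction Nm -> has_diagrams (star Hs))
  /\
  (explicit_local_satisfaction Nm -> has_i_sentences Nm ->
   explicit_global_satisfaction den -> has_diagrams (sharp S)).
Proof.
  split.
  - intros Hs Hat s M.
    destruct (model_diagram HS0 Hbeta0 den M _ (star_models den M Hat Hs))
      as [i [T _]].
    constructor. exact (@Build_Diagram (star Hs) s M (den_ext den M) _ i T).
  - intros Hat Hsen Hall s [M w].
    destruct (model_diagram HS0 Hbeta0 den M _ (fun K => iff_refl _))
      as [i [T Hi]].
    destruct (pointed_diagram HS w T Hi (sharp_models den M Hat Hsen Hall w))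
      as [j Tj].
    constructor.
    exact (@Build_Diagram (sharp S) s (mkSharp M w) (den_ext den M) _ j Tj).
Qed.
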